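(* Let $\gamma^*$ be the optimal value of the min-max problem $$\min_{K\in\mathbb{R}^{1\times n}}\ \max_{A\in\Sigma}\ \|G_{A,K}(z)\|_{\infty},\qquad G_{A,K}(z)=K(zI-A-BK)^{-1}B ,$$ where $\Sigma\subset\mathbb{R}^{n\times n}$ is the set of state matrices consistent with the data. Suppose that this problem is feasible (its optimal value $\gamma^*$ is finite). Let $\delta\in(0,1)$. Then there exists a stabilizing logarithmically quantized controller with density $\rho=(1-\delta)/(1+\delta)$ for all systems with $A\in\Sigma$ if and only if $\delta<1/\gamma^*$.
   Context: **Notation.** For symmetric matrices, $>0$, $\ge 0$ and $<0$ denote positive definite, positive semidefinite and negative definite; $I$ denotes the identity matrix. **System and data.** Consider $x(k+1)=A_{s}x(k)+Bu(k)+w(k)$ with state $x(k)\in\mathbb{R}^n$, scalar input $u(k)\in\mathbb{R}$, noise $w(k)\in\mathbb{R}^n$, unknown state matrix $A_{s}\in\mathbb{R}^{n\times n}$ and known $B\in\mathbb{R}^{n}$, with $(A_{s},B)$ stabilizable. A finite trajectory $x(0),u(0),x(1),u(1),\dots,x(T)$ of this system is given. The data matrices are $X_-=[x(0)\ \cdots\ x(T-1)]\in\mathbb{R}^{n\times T}$, $X_+=[x(1)\ \cdots\ x(T)]\in\mathbb{R}^{n\times T}$, $U=[u(0)\ \cdots\ u(T-1)]\in\mathbb{R}^{1\times T}$, and $X_U=X_+-BU$. The noise matrix $W=[w(0)\ \cdots\ w(T-1)]$ is unknown but satisfies $$\begin{bmatrix} I\\ W^{\top}\end{bmatrix}^{\top}\begin{bmatrix}\Phi_{11}&\Phi_{12}\\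 \Phi_{12}^{\top}&\Phi_{22}\end{bmatrix}\begin{bmatrix} I\\ W^{\top}\end{bmatrix}\ge 0,$$ where $\Phi_{11}\in\mathbb{R}^{n\times n}$ is a known symmetric matrix, $\Phi_{12}\in\mathbb{R}^{n\times T}$ is known, and $\Phi_{22}\in\mathbb{R}^{T\times T}$ is a known symmetric matrix with $\Phi_{22}<0$. The set of state matrices consistent with the data (it contains $A_{s}$) is $$\Sigma=\left\{A\in\mathbb{R}^{n\times n}:\ \begin{bmatrix} I\\ A^{\top}\end{bmatrix}^{\top}\begin{bmatrix} I & X_{U}\\ 0 & -X_{-}\end{bmatrix}\begin{bmatrix}\Phi_{11}&\Phi_{12}\\ \Phi_{12}^{\top}&\Phi_{22}\end{bmatrix}\begin{bmatrix} I & X_{U}\\ 0 & -X_{-}\end{bmatrix}^{\top}\begin{bmatrix} I\\ A^{\top}\end{bmatrix}\ge 0\right\}.$$ **$\mathcal{H}_\infty$ norm.** $\|G_{A,K}(z)\|_\infty=\sup_{|z|=1}|G_{A,K}(z)|$ if $A+BK$ is Schur stable (all eigenvalues in the open unit disc), and $\|G_{A,K}(z)\|_\infty=+\infty$ otherwise. The min and max are understood as infimum and supremum, and $1/\gamma^*=+\infty$ if $\gamma^*=0$. **Logarithmic quantizer.** Given $0<\rho<1$ (the quantization density), $\delta=\frac{1-\rho}{1+\rho}$ and $u_0>0$, let $u_i=\rho^{-i}u_0$ for $i\in\mathbb{Z}$. The logarithmic quantizer $f:\mathbb{R}\to\mathbb{R}$ with density $\rho$ is: $f(v)=u_i$ if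 $v>0$ and $\frac{1}{1+\delta}u_i<v\le\frac{1}{1-\delta}u_i$; $f(0)=0$; $f(v)=-f(-v)$ if $v<0$. A logarithmically quantized controller with density $\rho$ is $u(k)=f(v(k))$, $v(k)=Kx(k)$, with gain $K\in\mathbb{R}^{1\times n}$. **Stabilization.** Stabilization means quadratic stabilization of the noise-free closed loop: the controller with gain $K$ and density $\rho$ stabilizes the system with state matrix $A$ if there are a symmetric $P>0$ and $\varepsilon>0$ with $(Ax+Bf(Kx))^{\top}P(Ax+Bf(Kx))-x^{\top}Px\le-\varepsilon\|x\|^2$ for all $x\in\mathbb{R}^n$. It is stabilizing for all systems with $A\in\Sigma$ if the same $K$ stabilizes the system for every $A\in\Sigma$ ($P$ and $\varepsilon$ may depend on $A$). *)

(* Defs.v *)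
From HB Require Import structures.
From mathcomp Require Import all_boot all_order all_algebra.
From mathcomp Require Import complex.
From mathcomp Require Import all_classical all_reals ereal.

Set Implicit Arguments.
Unset Strict Implicit.
Unset Printing Implicit Defensive.

Import Order.TTheory GRing.Theory Num.Theory.

Local Open Scope classical_set_scope.
Local Open Scope ring_scope.

Section MatrixInequalities.
Variable R : realType.

Definition quad n (M : 'M[R]_n) (x : 'cV[R]_n) : R := (x^T *m M *m x) 0 0.

Definition posdef n (M : 'M[R]_n) : Prop :=
  M^T = M /\ forall x : 'cV[R]_n, x != 0 -> 0 < quad M x.

Definition possemidef n (M : 'M[R]_n) : Prop :=
  M^T = M /\ forall x : 'cV[R]_n, 0 <= quad M x.

Definition negdef n (M : 'M[R]_n) : Prop :=
  M^T = M /\ forall x : 'cV[R]_n, x != 0 -> quad M x < 0.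

Definition qmi n m (Pi : 'M[R]_(n + m)) (Z : 'M[R]_(n, m)) : Prop :=
  possemidef ((col_mx 1%:M Z^T)^T *m Pi *m col_mx 1%:M Z^T).

End MatrixInequalities.

Section Systems.
Variable R : realType.

(* The norm of R[i] takes values in R[i]; normc is its real-valued version. *)
Local Notation cabs := (@ComplexField.Normc.normc R).

Definition cmx m n (M : 'M[R]_(m, n)) : 'M[R[i]]_(m, n) :=
  map_mx (real_complex R) M.

Definition schur n (M : 'M[R]_n) : Prop :=
  forall z : R[i], eigenvalue (cmx M) z -> cabs z < 1.

Definition stabilizable n (A : 'M[R]_n) (B : 'cV[R]_n) : Prop :=
  exists K : 'rV[R]_n, schur (A + B *m K).

Definition transfer n (A : 'M[R]_n) (B : 'cV[R]_n) (K : 'rV[R]_n)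
    (z : R[i]) : R[i] :=
  (cmx K *m invmx (z%:M - cmx A - cmx B *m cmx K) *m cmx B) 0 0.

Definition hinf_norm n (A : 'M[R]_n) (B : 'cV[R]_n) (K : 'rV[R]_n) : \bar R :=
  if `[< schur (A + B *m K) >]
  then ereal_sup [set (cabs (transfer A B K z))%:E | z in [set z | cabs z = 1]]
  else +oo%E.

Definition minmax_value n (S : set 'M[R]_n) (B : 'cV[R]_n) : \bar R :=
  ereal_inf [set ereal_sup [set hinf_norm A B K | A in S] | K in [set: 'rV[R]_n]].

End Systems.

Section Data.
Variables (R : realType) (n T : nat).

Definition data_Xminus (x : nat -> 'cV[R]_n) : 'M[R]_(n, T) :=
  \matrix_(i < n, k < T) x k i 0.

Definition data_Xplus (x : nat -> 'cV[R]_n) : 'M[R]_(n, T) :=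
  \matrix_(i < n, k < T) x k.+1 i 0.

Definition data_U (u : nat -> R) : 'rV[R]_T := \row_(k < T) u k.

Definition data_W (w : nat -> 'cV[R]_n) : 'M[R]_(n, T) :=
  \matrix_(i < n, k < T) w k i 0.

Definition data_XU (B : 'cV[R]_n) (x : nat -> 'cV[R]_n) (u : nat -> R) :
    'M[R]_(n, T) :=
  data_Xplus x - B *m data_U u.

Definition consistent_set (Phi : 'M[R]_(n + T)) (B : 'cV[R]_n)
    (x : nat -> 'cV[R]_n) (u : nat -> R) : set 'M[R]_n :=
  let D : 'M[R]_(n + n, n + T) :=
    block_mx 1%:M (data_XU B x u) 0 (- data_Xminus x) in
  [set A | qmi (D *m Phi *m D^T) A].

End Data.

Section Quantizer.
Variable R : realType.

Definition quant_level (rho u0 : R) (i : int) : R := rho ^ (- i) * u0.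

(* For 0 < rho < 1 and 0 < u0, the cells of the levels partition the positive
   half-line: level_(i+1) / (1 + delta) = level_i / (1 - delta).  So exactly one
   y is admissible for v > 0 and the default value of xget is never used. *)
Definition quant_pos (rho u0 v : R) : R :=
  let delta := (1 - rho) / (1 + rho) in
  xget 0 [set y | exists i : int, [/\ y = quant_level rho u0 i,
    (1 + delta)^-1 * y < v & v <= (1 - delta)^-1 * y]].

Definition logquant (rho u0 v : R) : R :=
  if 0 < v then quant_pos rho u0 v
  else if v < 0 then - quant_pos rho u0 (- v)
  else 0.

Definition quantized_stabilizes n (rho u0 : R) (B : 'cV[R]_n)
    (K : 'rV[R]_n) (A : 'M[R]_n) : Prop :=
  exists (P : 'M[R]_n) (eps : R), [/\ posdef P, 0 < eps &
    forall x : 'cV[R]_n,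
      quad P (A *m x + logquant rho u0 ((K *m x) 0 0) *: B) - quad P x
        <= - eps * (x^T *m x) 0 0].

End Quantizer.

(* Main.v *)
Require Import Defs.
From mathcomp Require Import all_boot all_order all_algebra.
From mathcomp Require Import complex sesquilinear spectral.
From mathcomp Require Import all_classical all_reals ereal.
From mathcomp Require Import topology normedtype sequences derive.
From mathcomp Require Import ring lra.

Set Implicit Arguments.
Unset Strict Implicit.
Unset Printing Implicit Defensive.

Import Order.TTheory GRing.Theory Num.Def Num.Theory.
Import numFieldNormedType.Exports.

Local Open Scope classical_set_scope.
Local Open Scope ring_scope.

(** Put F = A + BK.  The quantizer error p = f(v) - v satisfies |p| <= delta |v|,
    and along each half-line of states f takes every slope 1 + D with
    D in [-delta, delta).  So, for one system, quantized quadratic stabilization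
    means that a single P decreases along x -> (F + D BK) x for all real D in the
    sector.  This turns out to be equivalent to F being Schur with
    delta |G(z)| < 1 on the unit circle.

    From the gain to P: this is the strict bounded real lemma [bounded_real].
    The matrix inequality wanted for P is affine in P, and a separation argument
    over the compact set of positive semidefinite matrices of trace one
    ([stein_alternative]) shows that if it has no solution there is a nonzero
    W >= 0 with [F B] W [F B]' = [I 0] W [I 0]' and nonnegative supply.  Factor
    W = Z Z^H: the matrices [F B] Z and [I 0] Z have the same Gram matrix, so up
    to an isometric change of columns they differ by one phase per column
    ([gram_phases]).  Each column is then a stationary response z y = F y + B q
    at a frequency |z| = 1, and the gain bound makes every column, hence W,
    vanish ([stein_solution_eq0]).  That P > 0 follows from F being Schur
    ([lyapunov_posdef]).

    From P to the gain: the perturbation D is real whereas responses at a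
    frequency z are complex.  If delta |G(z)| >= 1, the phase of the response can
    be chosen so that its real and imaginary parts satisfy the sector condition
    separately; each is then a genuine real perturbation, so P decreases strictly
    along both, while their total P-energy is conserved because |z| = 1
    ([gain_lt_of_quadratic_stability]).

    For the whole set Sigma, the gain must stay uniformly below 1 / delta.  The
    decrease of a fixed P survives small changes of A and a slightly larger sector
    ([gain_lt_near]), so it suffices that Sigma is compact.  It is closed, and the
    negative definite Phi22 bounds X_U - A X_-.  If the rows of X_- were dependent,
    Sigma would contain a line along a positive semidefinite rank-one direction,
    on which the trace of A + BK is unbounded, and not every A + BK could be
    Schur ([row_free_data]); hence X_- has a right inverse and A itself is
    bounded. *)

(** * Real quadratic forms *)

Section QuadraticForms.
Variable R : realType.

Definition bilin n (M : 'M[R]_n) (x y : 'cV[R]_n) : R := (x^T *m M *m y) 0 0.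

Definition sqnorm n (x : 'cV[R]_n) : R := (x^T *m x) 0 0.

Lemma bilinE n (M : 'M[R]_n) x y :
  bilin M x y = \sum_i \sum_j x i 0 * M i j * y j 0.
Proof.
rewrite /bilin mxE exchange_big /=; apply: eq_bigr => j _.
by rewrite mxE mulr_suml; apply: eq_bigr => i _; rewrite !mxE.
Qed.

Lemma sqnormE n (x : 'cV[R]_n) : sqnorm x = \sum_i x i 0 ^+ 2.
Proof. by rewrite /sqnorm mxE; apply: eq_bigr => i _; rewrite !mxE expr2. Qed.

Lemma sqnorm_ge0 n (x : 'cV[R]_n) : 0 <= sqnorm x.
Proof. by rewrite sqnormE sumr_ge0 // => i _; rewrite sqr_ge0. Qed.

Lemma sqnorm_eq0 n (x : 'cV[R]_n) : sqnorm x = 0 -> x = 0.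
Proof.
rewrite sqnormE => /eqP; rewrite psumr_eq0 => [/allP x0|i _]; last exact: sqr_ge0.
apply/colP => i; have /= := x0 i (mem_index_enum i).
by rewrite sqrf_eq0 mxE => /eqP.
Qed.

Lemma sqnorm_gt0 n (x : 'cV[R]_n) : x != 0 -> 0 < sqnorm x.
Proof.
move=> x0; rewrite lt_neqAle sqnorm_ge0 andbT eq_sym.
by apply: contra x0 => /eqP/sqnorm_eq0 ->.
Qed.

Lemma quad1 n (x : 'cV[R]_n) : quad 1%:M x = sqnorm x.
Proof. by rewrite /quad mulmx1. Qed.

Lemma bilinC n (M : 'M[R]_n) x y : M^T = M -> bilin M x y = bilin M y x.
Proof.
move=> MT; have -> : bilin M x y = (x^T *m M *m y)^T 0 0 by rewrite mxE.
by rewrite !trmx_mul trmxK MT mulmxA.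
Qed.

Lemma addmxE m n (A B : 'M[R]_(m, n)) i j : (A + B) i j = A i j + B i j.
Proof. by rewrite mxE. Qed.

Lemma quadD n (M : 'M[R]_n) (x y : 'cV[R]_n) : M^T = M ->
  quad M (x + y) = quad M x + 2 * bilin M x y + quad M y.
Proof.
move=> MT; have E : quad M (x + y) =
    quad M x + bilin M x y + (bilin M y x + quad M y).
  by rewrite /quad /bilin [(x + y)^T]linearD /= !mulmxDl !mulmxDr !addmxE.
by rewrite E (bilinC y x MT); ring.
Qed.

Lemma quadZ n (M : 'M[R]_n) a x : quad M (a *: x) = a ^+ 2 * quad M x.
Proof.
by rewrite /quad [(a *: x)^T]linearZ /= -!scalemxAl -scalemxAr !mxE mulrA expr2.
Qed.

Lemma bilinZr n (M : 'M[R]_n) a x y : bilin M x (a *: y) = a * bilin M x y.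
Proof. by rewrite /bilin -scalemxAr mxE. Qed.

Lemma quad_mxD n (M N : 'M[R]_n) x : quad (M + N) x = quad M x + quad N x.
Proof. by rewrite /quad mulmxDr mulmxDl mxE. Qed.

Lemma quad_mxN n (M : 'M[R]_n) x : quad (- M) x = - quad M x.
Proof. by rewrite /quad mulmxN mulNmx mxE. Qed.

Lemma quad_mxZ n (M : 'M[R]_n) a x : quad (a *: M) x = a * quad M x.
Proof. by rewrite /quad -scalemxAr -scalemxAl mxE. Qed.

Lemma quad_congr n m (M : 'M[R]_n) (A : 'M[R]_(n, m)) x :
  quad (A^T *m M *m A) x = quad M (A *m x).
Proof. by rewrite /quad trmx_mul !mulmxA. Qed.

Lemma sqnormZ n a (x : 'cV[R]_n) : sqnorm (a *: x) = a ^+ 2 * sqnorm x.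
Proof. by rewrite -!quad1 quadZ. Qed.

Lemma posdef_ge0 n (M : 'M[R]_n) x : posdef M -> 0 <= quad M x.
Proof.
case=> _ Mpos; have [->|/Mpos/ltW//] := eqVneq x 0.
by rewrite /quad mulmx0 mxE.
Qed.

Lemma cauchy_schwarz n (M : 'M[R]_n) x y : posdef M ->
  bilin M x y ^+ 2 <= quad M x * quad M y.
Proof.
move=> Mpos; have [MT _] := Mpos; have [y0|y0] := eqVneq y 0.
  by rewrite y0 /quad /bilin !mulmx0 !mxE expr0n mulr0.
have qy : 0 < quad M y by apply: (proj2 Mpos).
set b := bilin M x y; set q := quad M y in qy *.
(* The combination of x and y of least value, cleared of denominators. *)
have := posdef_ge0 (q *: x - b *: y) Mpos.
rewrite quadD // -scaleNr !quadZ bilinZr (bilinC (q *: x) _ MT) bilinZr.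
rewrite (bilinC y x MT) -/b -/q.
move=> h; have : 0 <= q * (quad M x * q - b ^+ 2).
  by apply: le_trans h _; rewrite le_eqVlt; apply/orP; left; apply/eqP; ring.
by rewrite pmulr_rge0 // subr_ge0.
Qed.

(** Cauchy-Schwarz against the vectors M^-1 e_i, whose M-product with x is the i-th
    coordinate of x, bounds each coordinate by the form. *)
Lemma sqnorm_le_posdef n (M : 'M[R]_n) : posdef M ->
  exists2 c, 0 < c & forall x, c * sqnorm x <= quad M x.
Proof.
move=> Mpos; have [MT Mgt] := Mpos.
have Mu : M \in unitmx.
  rewrite -row_free_unit -kermx_eq0; apply/eqP/row_matrixP => i; rewrite row0.
  apply/eqP; apply: contraTT isT => k0.
  have kM : row i (kermx M) *m M = 0 by rewrite -row_mul mulmx_ker row0.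
  have : (row i (kermx M))^T != 0 by rewrite trmx_eq0.
  by move=> /Mgt; rewrite /quad trmxK kM mul0mx mxE ltxx.
pose e i := invmx M *m (delta_mx i 0 : 'cV[R]_n).
have eE i x : bilin M (e i) x = x i 0.
  rewrite /bilin trmx_mul trmx_inv MT -(mulmxA _ (invmx M)) mulVmx // mulmx1.
  by rewrite trmx_delta -rowE mxE.
pose S := 1 + \sum_i quad M (e i).
have S_gt0 : 0 < S.
  by rewrite ltr_pwDl // sumr_ge0 // => i _; apply: posdef_ge0.
exists S^-1 => [|x]; first by rewrite invr_gt0.
rewrite ler_pdivrMl // mulrDl mul1r -[leLHS]add0r lerD ?posdef_ge0 //.
rewrite sqnormE mulr_suml ler_sum // => i _.
by rewrite -(eE i x) cauchy_schwarz.
Qed.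

Lemma quad_le_sqnorm n (M : 'M[R]_n) x :
  quad M x <= (\sum_i \sum_j `|M i j|) * sqnorm x.
Proof.
rewrite -[quad M x]/(bilin M x x) bilinE mulr_suml ler_sum // => i _.
rewrite mulr_suml ler_sum // => j _.
have xle k : x k 0 ^+ 2 <= sqnorm x.
  by rewrite sqnormE (bigD1 k) //= lerDl sumr_ge0 // => l _; rewrite sqr_ge0.
rewrite mulrAC mulrC (le_trans (ler_norm _)) // normrM ler_wpM2l //.
rewrite normrM -(@ler_pM2l _ 2) // (le_trans (y := `|x i 0| ^+ 2 + `|x j 0| ^+ 2)) //.
  by have := sqr_ge0 (`|x i 0| - `|x j 0|); lra.
by rewrite !real_normK ?num_real // mulr2n mulrDl !mul1r lerD.
Qed.

End QuadraticForms.

(** * Limits and compactness of matrices *)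

Section MatrixTopology.
Variable R : realType.

Lemma cvg_sumr (T I : Type) (F : set_system T) (FF : Filter F) (r : seq I)
    (f : I -> T -> R) (l : I -> R) : (forall i, f i @ F --> l i) ->
  (fun t => \sum_(i <- r) f i t) @ F --> \sum_(i <- r) l i.
Proof. by move=> fl; apply: cvg_big => //; exact: add_continuous. Qed.

Lemma cvg_mx (T : Type) (F : set_system T) (FF : Filter F) m n
    (f : T -> 'M[R]_(m, n)) (l : 'M[R]_(m, n)) :
  (forall i j, (fun t => f t i j) @ F --> l i j) -> f @ F --> l.
Proof.
move=> fl; apply/cvg_ballP => e e0.
have H : \forall t \near F, forall ij : 'I_m * 'I_n,
    ball (l ij.1 ij.2) e (f t ij.1 ij.2).
  apply: filter_forall => -[i j] /=.
  by have /cvg_ballP/(_ e e0) := fl i j.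
by near=> t; split => // i j; exact: (near H t _ (i, j)).
Unshelve. all: by end_near. Qed.

Lemma cvg_entry (T : Type) (F : set_system T) (FF : Filter F) m n
    (f : T -> 'M[R]_(m, n)) (l : 'M[R]_(m, n)) i j :
  f @ F --> l -> (fun t => f t i j) @ F --> l i j.
Proof.
move=> fl; apply: (cvg_comp _ (fun M : 'M[R]_(m, n) => M i j) fl).
exact: coord_continuous.
Qed.

Lemma cvg_mulmx (T : Type) (F : set_system T) (FF : Filter F) m n p
    (f : T -> 'M[R]_(m, n)) (g : T -> 'M[R]_(n, p))
    (a : 'M[R]_(m, n)) (b : 'M[R]_(n, p)) :
  f @ F --> a -> g @ F --> b -> (fun t => f t *m g t) @ F --> a *m b.
Proof.
move=> fa gb; apply: cvg_mx => i j; rewrite mxE.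
under eq_fun do rewrite mxE.
apply: cvg_sumr => k; apply: cvgM; exact: cvg_entry.
Qed.

Lemma cvg_trmx (T : Type) (F : set_system T) (FF : Filter F) m n
    (f : T -> 'M[R]_(m, n)) (a : 'M[R]_(m, n)) :
  f @ F --> a -> (fun t => (f t)^T) @ F --> a^T.
Proof.
move=> fa; apply: cvg_mx => i j; rewrite mxE.
by under eq_fun do rewrite mxE; exact: cvg_entry.
Qed.

(** Heine-Borel, transported from row vectors along [vec_mx]. *)
Lemma compact_mx m n (A : set 'M[R]_(m, n)) (b : R) : closed A ->
  (forall M, A M -> forall i j, `|M i j| <= b) -> compact A.
Proof.
move=> clA bA.
pose f (v : 'rV[R]_(m * n)) : 'M[R]_(m, n) := vec_mx v.
pose box := [set v : 'rV[R]_(m * n) | forall i, v ord0 i \in `[- b, b]].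
have cf : continuous f.
  move=> v; apply: (@cvg_mx _ (nbhs v)) => i j.
  rewrite /f mxE; under eq_fun do rewrite mxE.
  exact: coord_continuous.
have cbox : compact (f @` box).
  apply: continuous_compact; first exact: continuous_subspaceT.
  apply: (@rV_compact _ _ (fun=> `[- b, b]%classic)) => _.
  exact: segment_compact.
apply: (subclosed_compact clA cbox) => M AM; exists (mxvec M); last exact: mxvecK.
move=> k; case/mxvec_indexP: k => i j; rewrite mxvecE in_itv /= -ler_norml.
exact: bA.
Qed.

End MatrixTopology.

(** * A strict alternative for Stein-type matrix inequalities *)

Section StrictAlternative.
Variable R : realType.

Lemma closed_possemidef n : closed [set M : 'M[R]_n | possemidef M].
Proof.
have -> : [set M : 'M[R]_n | possemidef M] =
    (\bigcap_(ij in [set: 'I_n * 'I_n])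
       [set M : 'M[R]_n | M ij.1 ij.2 - M ij.2 ij.1 = 0]) `&`
    (\bigcap_(x in [set: 'cV[R]_n]) [set M : 'M[R]_n | 0 <= quad M x]).
  apply/seteqP; split => [M [MT Mpos]|M [MT Mpos]].
    split => [[i j] _|x _] /=; last exact: Mpos.
    by rewrite -{1}MT mxE subrr.
  split => [|x]; last exact: Mpos.
  by apply/matrixP => i j; rewrite mxE; apply/esym/subr0_eq/(MT (i, j)).
apply: closedI; apply: closed_bigI.
  move=> [i j] _; apply: (@preimage_closed _ _ (fun M : 'M[R]_n => M i j - M j i)
    [set x | x = 0]); last exact: closed_eq.
  by move=> M _; apply: (@cvgB _ _ _ (nbhs M));
    apply: (@cvg_entry _ _ (nbhs M)); exact: cvg_id.
move=> x _; apply: (@preimage_closed _ _ (fun M : 'M[R]_n => quad M x)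
    [set x | 0 <= x]); last exact: closed_ge.
move=> M _; apply: (@cvg_entry _ _ (nbhs M)); apply: cvg_mulmx; last exact: cvg_cst.
by apply: cvg_mulmx; [exact: cvg_cst|exact: cvg_id].
Qed.

(** The values of the form at e_i + e_j and e_i - e_j bound an off-diagonal entry
    by two diagonal ones; so trace-one positive semidefinite matrices form a
    bounded set. *)
Lemma possemidef_entry_le n (W : 'M[R]_n) i j : possemidef W ->
  `|W i j| <= \tr W.
Proof.
case=> WT Wpos.
have quadE (x : 'I_n) : quad W (delta_mx x 0) = W x x.
  by rewrite /quad trmx_delta -rowE -colE !mxE.
have Wdiag k : 0 <= W k k by rewrite -quadE.
have Wle k : W k k <= \tr W.
  by rewrite /mxtrace (bigD1 k) //= lerDl sumr_ge0.
have bE : bilin W (delta_mx i 0) (delta_mx j 0) = W i j.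
  by rewrite /bilin trmx_delta -rowE -colE !mxE.
have h1 := Wpos (delta_mx i 0 + delta_mx j 0).
have h2 := Wpos (delta_mx i 0 + (-1) *: delta_mx j 0).
rewrite quadD // !quadE bE in h1.
rewrite quadD // quadZ bilinZr !quadE bE in h2.
rewrite ler_norml; have := (Wle i); have := (Wle j); lra.
Qed.

Lemma mxtrace_rank1 n (M : 'M[R]_n) (v : 'cV[R]_n) :
  \tr (M *m (v *m v^T)) = quad M v.
Proof. by rewrite mulmxA mxtrace_mulC mulmxA /quad /mxtrace big_ord1. Qed.

Lemma possemidef_rank1 n (v : 'cV[R]_n) : possemidef (v *m v^T).
Proof.
split => [|x]; first by rewrite trmx_mul trmxK.
have -> : quad (v *m v^T) x = bilin 1%:M v x ^+ 2.
  rewrite /quad /bilin mulmx1 mulmxA -mulmxA.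
  have -> : x^T *m v = (v^T *m x)^T by rewrite trmx_mul trmxK.
  by rewrite mxE big_ord1 [X in X * _]mxE expr2.
exact: sqr_ge0.
Qed.

Lemma possemidefZ n a (M : 'M[R]_n) :
  0 <= a -> possemidef M -> possemidef (a *: M).
Proof.
move=> a0 [MT Mpos]; split => [|x]; first by rewrite linearZ /= MT.
by rewrite quad_mxZ mulr_ge0.
Qed.

Lemma possemidefD n (M1 M2 : 'M[R]_n) :
  possemidef M1 -> possemidef M2 -> possemidef (M1 + M2).
Proof.
move=> [M1T M1pos] [M2T M2pos]; split => [|x]; first by rewrite linearD /= M1T M2T.
by rewrite quad_mxD addr_ge0.
Qed.

(** First-order optimality on a segment: s is half the slope at l = 0 of a quadratic
    in l that is nonnegative on ]0, 1]. *)
Lemma first_order_ge0 (s k : R) :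
  (forall l, 0 < l -> l <= 1 -> 0 <= 2 * l * s + l ^+ 2 * k) -> 0 <= s.
Proof.
move=> h; rewrite leNgt; apply/negP => s0.
have [k0|k0] := lerP k 0.
  by have := h 1 ltr01 (lexx _); lra.
have d0 : 0 < k - s by lra.
have l0 : 0 < - s / (k - s) by rewrite divr_gt0 //; lra.
have l1 : - s / (k - s) <= 1 by rewrite ler_pdivrMr //; lra.
have := h _ l0 l1; set l := - s / (k - s) in l0 l1 *.
have lE : l * (k - s) = - s by rewrite /l divfK // gt_eqF.
have lk : l * k = l * s - s by lra.
have -> : 2 * l * s + l ^+ 2 * k = l * (2 * s + l * k) by ring.
by rewrite pmulr_rge0 // lk; nra.
Qed.

(** The adjoint, for the trace pairing, of P |-> E' P E - J' P J. *)
Definition stein n N (E J : 'M[R]_(n, N)) (W : 'M[R]_N) : 'M[R]_n :=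
  E *m W *m E^T - J *m W *m J^T.

(** Projection onto a cone: over the compact convex set of positive semidefinite
    matrices of trace one, minimize the squared distance g from
    (stein E J W, tr (D W)) to {0} x [0, +oo[.  A zero of g is the W of the second
    case.  Otherwise the residual at a minimizer W0 separates the whole image
    from that ray, and its matrix part, scaled and negated, is the P of the first
    case, as one sees by pairing it with rank-one matrices. *)
Lemma stein_alternative n N (E J : 'M[R]_(n, N)) (D : 'M[R]_N) : D^T = D ->
  (exists P : 'M[R]_n, P^T = P /\
     forall v, v != 0 -> quad (E^T *m P *m E - J^T *m P *m J + D) v < 0) \/
  (exists W : 'M[R]_N, [/\ possemidef W, \tr W = 1,
     E *m W *m E^T = J *m W *m J^T & 0 <= \tr (D *m W)]).
Proof.
move=> DT; case: N => [|N] in E J D DT *.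
  left; exists 0; split; first by rewrite trmx0.
  by move=> v; rewrite [v]flatmx0 eqxx.
pose S := [set W : 'M[R]_N.+1 | possemidef W] `&` [set W | \tr W = 1].
have cS : compact S.
  apply: (@compact_mx _ _ _ _ 1) => [|W [Wpos trW] i j]; last first.
    by rewrite -trW; exact: possemidef_entry_le.
  apply: closedI; first exact: closed_possemidef.
  apply: (@preimage_closed _ _ (fun M : 'M[R]_N.+1 => \tr M) [set x | x = 1]);
    last exact: closed_eq.
  move=> M _; apply: (@cvg_sumr _ _ _ (nbhs M)) => i.
  by apply: (@cvg_entry _ _ (nbhs M)); exact: cvg_id.
have Sv (v : 'cV[R]_N.+1) : v != 0 -> S ((sqnorm v)^-1 *: (v *m v^T)).
  move=> v0; have v_gt0 := sqnorm_gt0 v0; split.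
    by apply: possemidefZ; [rewrite invr_ge0 ltW|exact: possemidef_rank1].
  by rewrite /= mxtraceZ -[v *m _]mul1mx mxtrace_rank1 quad1 mulVf // gt_eqF.
have S0 : S !=set0.
  have v0 : (delta_mx 0 0 : 'cV[R]_N.+1) != 0.
    apply/negP => /eqP/matrixP/(_ 0 0); rewrite !mxE !eqxx => /eqP.
    by rewrite oner_eq0.
  by eexists; exact: Sv v0.
pose X := stein E J.
(* m W is the distance from the supply tr (D W) to the ray [0, +oo[. *)
pose m W := Num.max 0 (- \tr (D *m W)).
pose g W := \tr ((X W)^T *m X W) + m W ^+ 2.
have trE (A : 'M[R]_n) : \tr (A^T *m A) = \sum_i \sum_j A j i ^+ 2.
  by apply: eq_bigr => i _; rewrite mxE; apply: eq_bigr => j _; rewrite !mxE expr2.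
have cX : continuous X.
  move=> W; apply: (@cvgB _ _ _ (nbhs W)); apply: cvg_mulmx; try exact: cvg_cst;
    by apply: cvg_mulmx; [exact: cvg_cst|exact: cvg_id].
have ctr k (f : 'M[R]_N.+1 -> 'M[R]_k) : continuous f -> continuous (fun W => \tr (f W)).
  move=> cf W; apply: (@cvg_sumr _ _ _ (nbhs W)) => i.
  by apply: (@cvg_entry _ _ (nbhs W)); exact: cf.
have cg : continuous g.
  move=> W; apply: (@cvgD _ _ _ (nbhs W)).
    apply: ctr => {}W; apply: (@cvg_mulmx _ _ (nbhs W)); last exact: cX.
    by apply: cvg_trmx; exact: cX.
  have cm : {for W, continuous m}.
    apply: (@continuous_max _ _ (fun=> 0) (fun W => - \tr (D *m W))).
      exact: cst_continuous.
    apply: (@cvgN _ _ _ (nbhs W)); apply: ctr => {}W.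
    by apply: (@cvg_mulmx _ _ (nbhs W)); [exact: cvg_cst|exact: cvg_id].
  by apply: (@cvgM _ _ (nbhs W)); exact: cm.
have [W0 /set_mem[[W0T W0pos] trW0] W0min] :=
  compact_EVT_min S0 cS (continuous_subspaceT cg).
pose ip (A B : 'M[R]_n) := \tr (A^T *m B).
have ipC A B : ip A B = ip B A by rewrite /ip -mxtrace_tr trmx_mul trmxK.
have ipDr A B1 B2 : ip A (B1 + B2) = ip A B1 + ip A B2.
  by rewrite /ip mulmxDr linearD.
have ipZr A l B : ip A (l *: B) = l * ip A B by rewrite /ip -scalemxAr mxtraceZ.
have ipDD A l B : ip (A + l *: B) (A + l *: B) =
    ip A A + 2 * l * ip A B + l ^+ 2 * ip B B.
  by rewrite ipDr ipZr (ipC _ A) (ipC _ B) !ipDr !ipZr (ipC B A); ring.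
set X0 := X W0; set m0 := m W0; set t0 := \tr (D *m W0).
have ip_ge0 A : 0 <= ip A A.
  by rewrite /ip trE !sumr_ge0 // => i _; rewrite sumr_ge0 // => j _; rewrite sqr_ge0.
have m0_ge0 : 0 <= m0 by rewrite /m0 /m le_max lexx.
have m0t0 : m0 * t0 = - m0 ^+ 2.
  by rewrite /m0 /m -/t0; case: (lerP 0 (- t0)) => _; ring.
have gW0 : g W0 = ip X0 X0 + m0 ^+ 2 by [].
have [c0|c_neq0] := eqVneq (g W0) 0.
  right; exists W0; split => //.
    apply/eqP; rewrite -subr_eq0; apply/eqP; change (X0 = 0).
    have : ip X0 X0 = 0.
      by apply/eqP; rewrite eq_le ip_ge0 andbT; have := sqr_ge0 m0; lra.
    rewrite /ip trE => /eqP; rewrite psumr_eq0 => [/allP h|i _]; last first.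
      by rewrite sumr_ge0 // => j _; rewrite sqr_ge0.
    apply/matrixP => i j; have /= := h j (mem_index_enum j).
    rewrite psumr_eq0 => [/allP h'|k _]; last exact: sqr_ge0.
    by have /= := h' i (mem_index_enum i); rewrite sqrf_eq0 [RHS]mxE => /eqP.
  have : m0 ^+ 2 = 0 by have := ip_ge0 X0; have := sqr_ge0 m0; lra.
  move=> /eqP; rewrite sqrf_eq0 => /eqP m00.
  have : - t0 <= m0 by rewrite /m0 /m le_max lexx orbT.
  by rewrite m00 oppr_le0.
left; set c := g W0 in c_neq0 W0min gW0.
have c_gt0 : 0 < c.
  by rewrite lt_neqAle eq_sym c_neq0 gW0 addr_ge0 // sqr_ge0.
(* Optimality of W0 along the segment from W0 to W1: there the squared distance
   to the ray is at most (m0 - l (t1 - t0))^2, which is smooth in l. *)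
have key W1 : S W1 -> c <= ip X0 (X W1) - m0 * \tr (D *m W1).
  move=> SW1; have [W1pos trW1] := SW1; set t1 := \tr (D *m W1).
  set Y := X W1 - X0.
  suff : 0 <= ip X0 Y - m0 * (t1 - t0).
    rewrite /Y -scaleN1r ipDr ipZr gW0; move: m0t0; lra.
  apply: (@first_order_ge0 _ (ip Y Y + (t1 - t0) ^+ 2)) => l l0 l1.
  pose Wl := (1 - l) *: W0 + l *: W1.
  have SWl : S Wl.
    split; last by rewrite /= linearD /= !mxtraceZ trW0 trW1; ring.
    by apply: possemidefD; apply: possemidefZ; rewrite ?subr_ge0 // ltW.
  have XWl : X Wl = X0 + l *: Y.
    rewrite /Y /X0 /X /stein /Wl !mulmxDr !mulmxDl -!scalemxAr -!scalemxAl.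
    apply/matrixP => i j; rewrite !(mxE, mulmxA); ring.
  have tWl : \tr (D *m Wl) = t0 + l * (t1 - t0).
    rewrite /Wl mulmxDr -!scalemxAr linearD /= !mxtraceZ -/t0 -/t1; ring.
  have mWl : m Wl ^+ 2 <= (m0 - l * (t1 - t0)) ^+ 2.
    rewrite -[leRHS]real_normK ?num_real // ler_sqr ?nnegrE //; last first.
      by rewrite /m le_max lexx.
    rewrite /m tWl ge_max normr_ge0 /=.
    apply: le_trans (ler_norm _).
    have : - t0 <= m0 by rewrite /m0 /m le_max lexx orbT.
    lra.
  have := W0min _ (mem_set SWl); rewrite gW0 /g -/(ip _ _) XWl.
  rewrite ipDD.
  by move: mWl; lra.
pose tau := \sum_i \sum_j `|D i j|.
have tau_ge0 : 0 <= tau by rewrite !sumr_ge0 // => i _; rewrite sumr_ge0.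
(* A positive eta keeps the scaling m0 + eta invertible when m0 = 0; this one is
   small enough for eta * quad D v to stay below the gap c * sqnorm v. *)
pose eta := c / (tau + 1).
have eta0 : 0 < eta by rewrite divr_gt0 // ltr_wpDl.
have etaE : eta * (tau + 1) = c by rewrite divfK // gt_eqF // ltr_wpDl.
have s0 : 0 < m0 + eta by rewrite ltr_wpDl.
have X0T : X0^T = X0.
  by rewrite /X0 /X /stein linearB /= !trmx_mul !trmxK W0T !mulmxA.
exists (- (m0 + eta)^-1 *: X0); split; first by rewrite linearZ /= X0T.
move=> v v0; have v_gt0 := sqnorm_gt0 v0.
have := key _ (Sv v v0).
have -> : X ((sqnorm v)^-1 *: (v *m v^T)) = (sqnorm v)^-1 *: X (v *m v^T).
  by rewrite /X /stein -!scalemxAr -!scalemxAl scalerBr.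
rewrite ipZr -scalemxAr mxtraceZ mxtrace_rank1.
have -> : ip X0 (X (v *m v^T)) = quad (E^T *m X0 *m E - J^T *m X0 *m J) v.
  rewrite /ip X0T /X /stein mulmxBr linearB /= quad_mxD quad_mxN !quad_congr.
  congr (_ - _).
    rewrite -mxtrace_rank1 trmx_mul !mulmxA; congr (\tr _).
  rewrite -mxtrace_rank1 trmx_mul !mulmxA; congr (\tr _).
have -> : E^T *m (- (m0 + eta)^-1 *: X0) *m E - J^T *m (- (m0 + eta)^-1 *: X0) *m J + D
  = - (m0 + eta)^-1 *: (E^T *m X0 *m E - J^T *m X0 *m J) + D.
  by rewrite -!scalemxAr -!scalemxAl scalerBr.
rewrite [X in _ -> X < _]quad_mxD quad_mxZ.
set q := quad (_ - _) v; set t := quad D v.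
have tle : t <= tau * sqnorm v := quad_le_sqnorm D v.
rewrite mulrCA -mulrBr mulrC ler_pdivlMr // => h.
rewrite mulNr mulrC addrC subr_lt0 ltr_pdivlMr //.
have : eta * t < c * sqnorm v.
  rewrite -etaE -mulrA ltr_pM2l // mulrDl mul1r.
  by apply: le_lt_trans tle _; rewrite ltrDl.
lra.
Qed.

End StrictAlternative.

(** * Complex matrices with equal Gram matrices *)

Section Gram.
Local Open Scope sesquilinear_scope.
Variable C : numClosedFieldType.

Lemma adjM m n p (A : 'M[C]_(m, n)) (B : 'M[C]_(n, p)) :
  (A *m B)^t* = B^t* *m A^t*.
Proof. by rewrite trmx_mul map_mxM. Qed.

Lemma adjB m n (A B : 'M[C]_(m, n)) : (A - B)^t* = A^t* - B^t*.
Proof. by apply/matrixP => i j; rewrite !mxE rmorphB. Qed.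

Lemma adj1 n : (1%:M : 'M[C]_n)^t* = 1%:M.
Proof. by rewrite trmx1 map_mx1. Qed.

Lemma adj_diag n (d : 'rV[C]_n) : (diag_mx d)^t* = diag_mx (map_mx conjC d).
Proof. by rewrite tr_diag_mx map_diag_mx. Qed.

Lemma mulmx_adj_diag m n (A : 'M[C]_(m, n)) i :
  (A *m A^t*) i i = \sum_j `|A i j| ^+ 2.
Proof. by rewrite mxE; apply: eq_bigr => j _; rewrite !mxE normCK. Qed.

Lemma mulmx_adj_eq0 m n (A : 'M[C]_(m, n)) : A *m A^t* = 0 -> A = 0.
Proof.
move=> A0; apply/matrixP => i j; rewrite [RHS]mxE.
have /eqP := mulmx_adj_diag A i; rewrite A0 mxE eq_sym psumr_eq0; last first.
  by move=> k _; rewrite exprn_ge0.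
move=> /allP/(_ j); rewrite mem_index_enum => /(_ isT)/=.
by rewrite sqrf_eq0 normr_eq0 => /eqP.
Qed.

Lemma hermitian_diagonalization n (H : 'M[C]_n) : H^t* = H ->
  exists (P : 'M[C]_n) (d : 'rV[C]_n), [/\ P *m P^t* = 1%:M, P^t* *m P = 1%:M,
    forall i, d 0 i \is Num.real & H = P^t* *m diag_mx d *m P].
Proof.
move=> Hh; have Hherm : H \is hermsymmx.
  by apply/is_hermitianmxP; rewrite expr0 scale1r.
have Pu := spectral_unitarymx H.
exists (spectralmx H), (spectral_diag H); split.
- exact/unitarymxP.
- by rewrite -invmx_unitary // mulVmx // spectral_unit.
- by move=> i; have /mxOverP := hermitian_spectral_diag_real Hherm; apply.
- by rewrite -invmx_unitary //; apply/orthomx_spectralP/hermitian_normalmx.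
Qed.

Lemma psd_factorization n (H : 'M[C]_n) : H^t* = H ->
  (forall v : 'rV[C]_n, 0 <= (v *m H *m v^t*) 0 0) ->
  exists Z : 'M[C]_n, H = Z *m Z^t*.
Proof.
move=> Hh Hpos; have [P [d [PP P'P dR HE]]] := hermitian_diagonalization Hh.
have d_ge0 i : 0 <= d 0 i.
  have -> : d 0 i = (P *m H *m P^t*) i i.
    by rewrite HE !mulmxA PP mul1mx -mulmxA PP mulmx1 mxE eqxx mulr1n.
  have := Hpos (row i P); rewrite -row_mul mxE [in X in _ -> X]mxE.
  by under eq_bigr do rewrite !mxE; under [in X in _ -> X]eq_bigr do rewrite !mxE.
exists (P^t* *m diag_mx (map_mx sqrtC d)).
rewrite adjM adj_diag trmxCK HE mulmxA; congr (_ *m _); rewrite -mulmxA.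
congr (_ *m _); rewrite mulmx_diag; congr diag_mx; apply/rowP => i; rewrite !mxE.
by rewrite -normCK ger0_norm ?sqrtC_ge0 // sqrtCK.
Qed.

(** The Moore-Penrose inverse: since the inverse of 0 is 0, inverting the
    eigenvalues one by one also takes care of the kernel. *)
Lemma hermitian_pinv n (H : 'M[C]_n) : H^t* = H ->
  exists G : 'M[C]_n, [/\ G^t* = G, H *m G *m H = H & G *m H *m G = G].
Proof.
move=> Hh; have [P [d [PP P'P dR HE]]] := hermitian_diagonalization Hh.
have dd e f : P^t* *m diag_mx e *m P *m (P^t* *m diag_mx f *m P) =
    P^t* *m diag_mx (\row_i (e 0 i * f 0 i)) *m P.
  by rewrite !mulmxA -(mulmxA _ P (P^t*)) PP mulmx1 -(mulmxA _ (diag_mx e)) mulmx_diag.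
exists (P^t* *m diag_mx (map_mx (fun x => x^-1) d) *m P); split.
- rewrite !adjM adj_diag trmxCK mulmxA; congr (_ *m diag_mx _ *m _).
  by apply/rowP => i; rewrite !mxE; apply/CrealP; rewrite rpredV.
- rewrite HE !dd; congr (_ *m diag_mx _ *m _); apply/rowP => i; rewrite !mxE.
  have [->|d0] := eqVneq (d 0 i) 0; first by rewrite mulr0.
  by rewrite divff // mul1r.
- rewrite HE !dd; congr (_ *m diag_mx _ *m _); apply/rowP => i; rewrite !mxE.
  have [->|d0] := eqVneq (d 0 i) 0; first by rewrite invr0 mulr0.
  by rewrite mulVf // mul1r.
Qed.

(** With G the pseudo-inverse of the common Gram matrix, T = Y^H G X is a partial
    isometry and Y T = X.  The zero columns leave room for its Halmos dilation,
    which is unitary. *)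
Lemma gram_unitary n m (X Y : 'M[C]_(n, m)) : X *m X^t* = Y *m Y^t* ->
  exists2 U : 'M[C]_(m + m), U \is unitarymx &
    row_mx X 0 = row_mx Y 0 *m U.
Proof.
move=> XY; set H := X *m X^t* in XY.
have Hh : H^t* = H by rewrite adjM trmxCK.
have [G [Gh HGH GHG]] := hermitian_pinv Hh.
have fixrange (Z : 'M[C]_(n, m)) : Z *m Z^t* = H -> H *m G *m Z = Z.
  move=> ZH; apply/eqP; rewrite -subr_eq0; apply/eqP/mulmx_adj_eq0.
  have -> : H *m G *m Z - Z = (H *m G - 1%:M) *m Z by rewrite mulmxBl mul1mx.
  by rewrite adjM mulmxA -(mulmxA _ Z) ZH mulmxBl HGH mul1mx subrr mul0mx.
have HGX := fixrange X erefl; have HGY := fixrange Y (esym XY).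
pose T := Y^t* *m G *m X.
have Th : T^t* = X^t* *m G *m Y by rewrite !adjM trmxCK Gh mulmxA.
have YT : Y *m T = X by rewrite /T !mulmxA -XY HGX.
have TT : T *m T^t* = Y^t* *m G *m Y.
  by rewrite Th /T !mulmxA -(mulmxA _ X) -/H -(mulmxA (Y^t*)) -(mulmxA (Y^t*)) GHG.
have YTT : Y *m (T *m T^t*) = Y by rewrite TT !mulmxA -XY HGY.
have TTT : T *m T^t* *m T = T.
  by rewrite TT -mulmxA YT.
clearbody T.
have TTT' : T^t* *m T *m T^t* = T^t*.
  by have := congr1 (fun M => M^t*) TTT; rewrite !adjM trmxCK !mulmxA.
(* In the Halmos dilation, 1 - T T^H and 1 - T^H T are projections, hence their
   own square roots. *)
exists (block_mx T (1%:M - T *m T^t*) (1%:M - T^t* *m T) (- T^t*)); last first.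
  by rewrite mul_row_block !mul0mx !addr0 YT mulmxBr mulmx1 YTT subrr.
apply/unitarymxP; rewrite tr_block_mx map_block_mx.
have -> : (- T^t*)^T ^ conjC = - T by rewrite linearN /= map_mxN trmxCK.
rewrite !adjB !adjM !adj1 trmxCK mulmx_block.
rewrite !mulmxBr !mulmxBl !mulmxN !mulNmx !mulmx1 !mul1mx !mulmxA TTT TTT' opprK.
by rewrite !subrr addNr !subr0 !addr0 opprK subrK addrC subrK -scalar_mx_block.
Qed.

(** The unitary matrix linking X and Y after padding is diagonalizable by a unitary
    matrix, and its eigenvalues are phases. *)
Lemma gram_phases n m (X Y : 'M[C]_(n, m)) : X *m X^t* = Y *m Y^t* ->
  exists (V : 'M[C]_(m, m + m)) (d : 'rV[C]_(m + m)),
    [/\ V *m V^t* = 1%:M, forall k, `|d 0 k| = 1 &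
        X *m V = Y *m V *m diag_mx d].
Proof.
move=> /gram_unitary[U Uu XYU].
have Un : U \is normalmx.
  apply/normalmxP; rewrite (unitarymxP Uu).
  by rewrite -invmx_unitary // mulVmx // unitarymx_unit.
have /orthomx_spectralP := Un; set P := spectralmx U; set d := spectral_diag U.
have Pu : P \is unitarymx := spectral_unitarymx U.
have PP := unitarymxP Pu; rewrite invmx_unitary // => UE.
have P'P : P^t* *m P = 1%:M by rewrite -invmx_unitary // mulVmx ?spectral_unit.
exists (row_mx 1%:M 0 *m P^t*), d; split.
- rewrite adjM trmxCK mulmxA -(mulmxA _ _ P) P'P mulmx1.
  by rewrite tr_row_mx map_col_mx mul_row_col mul0mx addr0 adj1 mulmx1.
- move=> k; have : diag_mx d *m (diag_mx d)^t* = 1%:M.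
    have -> : diag_mx d = P *m U *m P^t*.
      by rewrite UE !mulmxA PP mul1mx -mulmxA PP mulmx1.
    rewrite !adjM trmxCK !mulmxA -(mulmxA _ (P^t*)) P'P mulmx1.
    by rewrite -(mulmxA P) (unitarymxP Uu) mulmx1 PP.
  rewrite adj_diag mulmx_diag => /matrixP/(_ k k); rewrite !mxE eqxx !mulr1n.
  by rewrite -normCK => /eqP; rewrite sqrp_eq1 // => /eqP.
- have e (A : 'M[C]_(n, m)) : row_mx A 0 = A *m row_mx 1%:M 0 :> 'M_(n, m + m).
    by rewrite mul_mx_row mulmx1 mulmx0.
  rewrite !mulmxA -!e XYU UE !mulmxA -(mulmxA _ P) PP mulmx1.
  by [].
Qed.

End Gram.

(** * Real matrices over the complex numbers *)

Section Complexification.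
Local Open Scope sesquilinear_scope.
Variable R : realType.
Local Notation C := R[i].
Local Notation re := (@complex.Re R).
Local Notation im := (@complex.Im R).
Local Notation cabs := (@ComplexField.Normc.normc R).

Lemma normE (z : C) : `|z| = (cabs z)%:C%C.
Proof. by []. Qed.

Lemma cabs1 (z : C) : cabs z = 1 <-> `|z| = 1.
Proof. by rewrite normE; split => [->//|/(congr1 re)]. Qed.

Lemma cmxM m n p (A : 'M[R]_(m, n)) (B : 'M[R]_(n, p)) :
  cmx (A *m B) = cmx A *m cmx B.
Proof. exact: map_mxM. Qed.

Lemma cmxD m n (A B : 'M[R]_(m, n)) : cmx (A + B) = cmx A + cmx B.
Proof. exact: map_mxD. Qed.

Lemma cmx_adj m n (A : 'M[R]_(m, n)) : (cmx A)^t* = cmx A^T.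
Proof. by apply/matrixP => i j; rewrite !mxE; apply: conjc_real. Qed.

Lemma cmx_inj m n : injective (@cmx R m n).
Proof.
move=> A B /matrixP E; apply/matrixP => i j.
by have := E i j; rewrite !mxE => -[].
Qed.

Definition Remx m n (A : 'M[C]_(m, n)) : 'M[R]_(m, n) := map_mx re A.
Definition Immx m n (A : 'M[C]_(m, n)) : 'M[R]_(m, n) := map_mx im A.

Lemma re_sum (I : Type) (r : seq I) (f : I -> C) :
  re (\sum_(i <- r) f i) = \sum_(i <- r) re (f i).
Proof. exact: (raddf_sum (re )). Qed.

Lemma im_sum (I : Type) (r : seq I) (f : I -> C) :
  im (\sum_(i <- r) f i) = \sum_(i <- r) im (f i).
Proof. exact: (raddf_sum (im )). Qed.

Lemma Remx_cmxM m n p (A : 'M[R]_(m, n)) (B : 'M[C]_(n, p)) :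
  Remx (cmx A *m B) = A *m Remx B.
Proof.
apply/matrixP => i j; rewrite !mxE re_sum; apply: eq_bigr => k _.
by rewrite !mxE; case: (B k j) => a b /=; rewrite mul0r subr0.
Qed.

Lemma Immx_cmxM m n p (A : 'M[R]_(m, n)) (B : 'M[C]_(n, p)) :
  Immx (cmx A *m B) = A *m Immx B.
Proof.
apply/matrixP => i j; rewrite !mxE im_sum; apply: eq_bigr => k _.
by rewrite !mxE; case: (B k j) => a b /=; rewrite mul0r addr0.
Qed.

Lemma not_eigenvalue_unit n (F : 'M[C]_n) z : ~~ eigenvalue F z -> z%:M - F \in unitmx.
Proof.
rewrite /eigenvalue negbK /eigenspace kermx_eq0 row_free_unit.
by rewrite -(unitmxZ (F - _) (unitrN1 _)) scaleN1r opprB.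
Qed.

Lemma schur_unit n (F : 'M[R]_n) (z : C) : schur F -> cabs z = 1 ->
  z%:M - cmx F \in unitmx.
Proof.
by move=> sF z1; apply: not_eigenvalue_unit; apply/negP => /sF; rewrite z1 ltxx.
Qed.

End Complexification.

(** * Stationary responses and the frequency inequality *)

Section BoundedReal.
Local Open Scope sesquilinear_scope.
Variable R : realType.
Local Notation C := R[i].
Local Notation cabs := (@ComplexField.Normc.normc R).

(** The transfer function from p to K y of the system z y = F y + B p. *)
Definition siso_gain n (F : 'M[R]_n) (B : 'cV[R]_n) (K : 'rV[R]_n) (z : C) : C :=
  (cmx K *m invmx (z%:M - cmx F) *m cmx B) 0 0.

(** The Hermitian form of a real symmetric matrix at x + i y is the sum of its
    values at x and at y. *)
Lemma cmx_possemidef n (W : 'M[R]_n) : possemidef W ->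
  exists Z : 'M[C]_n, cmx W = Z *m Z^t*.
Proof.
move=> [WT Wpos]; apply: psd_factorization => [|v]; first by rewrite cmx_adj WT.
set x := (Remx v)^T; set y := (Immx v)^T.
have -> : (v *m cmx W *m v^t*) 0 0 =
    \sum_i \sum_j v 0 i * (W i j)%:C%C * conjc (v 0 j).
  rewrite mxE exchange_big /=; apply: eq_bigr => j _.
  by rewrite mxE mulr_suml; apply: eq_bigr => i _; rewrite !mxE.
rewrite lecE im_sum re_sum /=; apply/andP; split; last first.
  have -> : \sum_i complex.Re (\sum_j v 0 i * (W i j)%:C%C * conjc (v 0 j)) =
      quad W x + quad W y.
    rewrite -[quad W x]/(bilin W x x) -[quad W y]/(bilin W y y) !bilinE -big_split.
    apply: eq_bigr => i _; rewrite re_sum -big_split; apply: eq_bigr => j _ /=.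
    by rewrite !mxE; case: (v 0 i) => a b; case: (v 0 j) => c e /=; ring.
  by rewrite addr_ge0.
apply/eqP; transitivity (bilin W y x - bilin W x y); last first.
  by rewrite (bilinC y x WT) subrr.
rewrite !bilinE -sumrB; apply: eq_bigr => i _.
rewrite im_sum -sumrB; apply: eq_bigr => j _ /=.
by rewrite !mxE; case: (v 0 i) => a b; case: (v 0 j) => c e /=; ring.
Qed.

Lemma col_mulmx m n p (A : 'M[C]_(m, n)) (M : 'M[C]_(n, p)) k :
  col k (A *m M) = A *m col k M.
Proof. by rewrite !colE mulmxA. Qed.

(** Factor W = Z Z^H.  The equation says that [F B] Z and [I 0] Z have the same
    Gram matrix; after an isometric change of columns, which does not affect W,
    column k of Z is a response (y_k, q_k) at a frequency d_k on the unit circle: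
    d_k y_k = F y_k + B q_k.  The trace is then the sum of
    |K y_k|^2 - |q_k|^2 = (|G(d_k)|^2 - 1) |q_k|^2, so all q_k and y_k vanish. *)
Lemma stein_solution_eq0 n (F : 'M[R]_n) (B : 'cV[R]_n) (K : 'rV[R]_n)
    (W : 'M[R]_(n + 1)) :
  schur F -> (forall z, cabs z = 1 -> cabs (siso_gain F B K z) < 1) ->
  possemidef W ->
  row_mx F B *m W *m (row_mx F B)^T = row_mx 1%:M 0 *m W *m (row_mx 1%:M 0)^T ->
  0 <= \tr (block_mx (K^T *m K) 0 0 (- 1%:M) *m W) -> W = 0.
Proof.
move=> sF gF /cmx_possemidef[Z WE] EWJ trW.
pose E := row_mx F B; pose J : 'M[R]_(n, n + 1) := row_mx 1%:M 0.
have XY : cmx E *m Z *m (cmx E *m Z)^t* = cmx J *m Z *m (cmx J *m Z)^t*.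
  rewrite !adjM !mulmxA -(mulmxA _ Z) -WE -(mulmxA (cmx J) Z) -WE.
  by rewrite !cmx_adj -!cmxM EWJ.
have [V [d [VV d1 XVY]]] := gram_phases XY.
pose y := usubmx (Z *m V); pose q := dsubmx (Z *m V).
have ZV : Z *m V = col_mx y q by rewrite vsubmxK.
have JZ : cmx J *m Z *m V = y.
  by rewrite -mulmxA ZV /cmx map_row_mx map_mx1 map_mx0 mul_row_col mul1mx mul0mx addr0.
have EZ : cmx E *m Z *m V = cmx F *m y + cmx B *m q.
  by rewrite -mulmxA ZV /cmx map_row_mx mul_row_col.
rewrite JZ EZ in XVY.
have ycol k : col k y = q 0 k *: (invmx ((d 0 k)%:M - cmx F) *m cmx B).
  have u := schur_unit sF (proj2 (cabs1 (d 0 k)) (d1 k)).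
  apply: (can_inj (mulKmx u)); rewrite -scalemxAr mulKVmx //.
  rewrite mulmxBl mul_scalar_mx.
  have := congr1 (col k) XVY; rewrite linearD /= !col_mulmx.
  have -> : y *m col k (diag_mx d) = d 0 k *: col k y.
    by rewrite -col_mulmx; apply/colP => i; rewrite mul_mx_diag !mxE mulrC.
  have -> : col k q = (q 0 k)%:M by apply/colP => j; rewrite !ord1 !mxE eqxx.
  by rewrite mul_mx_scalar => <-; rewrite addrC addKr.
pose Ky := cmx K *m y.
have Kyk k : Ky 0 k = q 0 k * siso_gain F B K (d 0 k).
  have -> : Ky 0 k = (cmx K *m col k y) 0 0 by rewrite -col_mulmx [RHS]mxE.
  by rewrite ycol -scalemxAr mxE mulmxA.
have trE : (\tr (block_mx (K^T *m K) 0 0 (- 1%:M) *m W))%:C%C =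
    \sum_k (`|Ky 0 k| ^+ 2 - `|q 0 k| ^+ 2).
  have -> (M : 'M[R]_(n + 1)) : (\tr M)%:C%C = \tr (cmx M).
    by rewrite /mxtrace rmorph_sum; apply: eq_bigr => i _; rewrite mxE.
  have ZZ : Z *m Z^t* = Z *m V *m (Z *m V)^t*.
    by rewrite adjM mulmxA -(mulmxA Z) VV mulmx1.
  rewrite cmxM WE ZZ mulmxA ZV /cmx map_block_mx map_mxM !map_mx0 map_mxN map_mx1.
  rewrite mul_block_col !mul0mx addr0 add0r mulNmx mul1mx.
  rewrite tr_col_mx map_row_mx mul_col_row mxtrace_block mulNmx linearN /= sumrB.
  congr (_ - _).
    rewrite -/(cmx _) -/(cmx _) -mulmxA -/Ky -cmx_adj -mulmxA mxtrace_mulC -mulmxA.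
    rewrite -(mulmxA y) -adjM -/Ky mulmxA -/Ky.
    by rewrite /mxtrace big_ord1 mulmx_adj_diag.
  by rewrite /mxtrace big_ord1 mulmx_adj_diag.
have gain k : `|siso_gain F B K (d 0 k)| < 1.
  by rewrite normE ltcR gF // (proj2 (cabs1 _) (d1 k)).
have term k : 0 <= `|q 0 k| ^+ 2 - `|Ky 0 k| ^+ 2.
  rewrite subr_ge0 Kyk normrM exprMn ler_piMr ?exprn_ge0 //.
  by rewrite exprn_ile1 // ltW.
have q0 k : q 0 k = 0.
  have : \sum_k (`|q 0 k| ^+ 2 - `|Ky 0 k| ^+ 2) == 0.
    rewrite eq_le sumr_ge0 // andbT -oppr_ge0 -sumrN.
    by under eq_bigr do rewrite opprB; rewrite -trE ler0c.
  rewrite psumr_eq0 // => /allP/(_ k (mem_index_enum k)) /=.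
  rewrite Kyk normrM exprMn -{1}[_ ^+ 2]mulr1 -mulrBr mulf_eq0 => /orP[].
    by rewrite sqrf_eq0 normr_eq0 => /eqP.
  by rewrite subr_eq0 eq_sym sqrp_eq1 // lt_eqF.
have ZV0 : Z *m V = 0.
  rewrite ZV -col_mx0; congr col_mx; apply/matrixP => i k.
    by have /colP/(_ i) := ycol k; rewrite q0 scale0r !mxE.
  by rewrite ord1 q0 mxE.
have Z0 : Z = 0 by rewrite -[Z]mulmx1 -VV mulmxA ZV0 mul0mx.
by apply: cmx_inj; rewrite WE Z0 mul0mx [RHS]map_mx0.
Qed.

End BoundedReal.

(** * Schur stability and Lyapunov functions *)

Section SchurStability.
Variable R : realType.
Local Notation C := R[i].
Local Notation cabs := (@ComplexField.Normc.normc R).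

Lemma cabs_ge0 (z : C) : 0 <= cabs z.
Proof. by case: z => a b; rewrite sqrtr_ge0. Qed.

Lemma schur_char_poly n (F : 'M[R]_n) : schur F ->
  exists2 s : seq C, char_poly (cmx F) = \prod_(z <- s) ('X - z%:P) &
    forall z, z \in s -> cabs z < 1.
Proof.
move=> sF; have [s sE] := closed_field_poly_normal (char_poly (cmx F)).
rewrite (monicP (char_poly_monic _)) scale1r in sE.
exists s => // z zs; apply: sF; rewrite eigenvalue_root_char sE.
by rewrite root_prod_XsubC.
Qed.

(** The trace is the sum of the eigenvalues. *)
Lemma schur_trace_le n (F : 'M[R]_n) : schur F -> `|\tr F| <= n%:R.
Proof.
case: n F => [|n] F sF; first by rewrite /mxtrace big_ord0 normr0.
have [s sE s1] := schur_char_poly sF.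
have size_s : size s = n.+1.
  by have := size_char_poly (cmx F); rewrite sE size_prod_XsubC => -[].
have trE : \tr (cmx F) = \sum_(z <- s) z.
  have := coefPn_prod_XsubC (ps := s); rewrite size_s => /(_ isT) cE.
  by have := char_poly_trace (cmx F) isT; rewrite sE cE => /oppr_inj.
have -> : `|\tr F| = cabs (\sum_(z <- s) z).
  rewrite -trE /mxtrace; under [in RHS]eq_bigr do rewrite mxE.
  rewrite -rmorph_sum /= /ComplexField.Normc.normc /=.
  by rewrite expr0n /= addr0 sqrtr_sqr.
rewrite -size_s; elim: s s1 {sE size_s trE} => [|z s IH] s1.
  by rewrite big_nil /ComplexField.Normc.normc /= expr0n addr0 sqrtr0.
rewrite big_cons; apply: le_trans (le_normcD _ _) _.
rewrite /= -[X in _ <= X%:R]addn1 natrD addrC lerD //.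
  by apply: IH => y ys; apply: s1; rewrite inE ys orbT.
by rewrite ltW // s1 // mem_head.
Qed.

(** The sequence b r^k dominates a as soon as b (r - rho) >= c. *)
Lemma geometric_recurrence (a : nat -> R) (rho r c : R) :
  0 <= rho -> rho < r -> 0 <= c ->
  (forall k, a k.+1 <= rho * a k + c * r ^+ k) ->
  exists2 b, 0 <= b & forall k, a k <= b * r ^+ k.
Proof.
move=> rho0 rhor c0 aS; pose b := Num.max `|a 0| (c / (r - rho)).
have rr : 0 < r - rho by rewrite subr_gt0.
have b0 : 0 <= b by rewrite le_max normr_ge0.
have cb : c <= b * (r - rho) by rewrite -ler_pdivrMr // le_max lexx orbT.
have r0 : 0 <= r by lra.
exists b => //; elim=> [|k IH].
  by rewrite expr0 mulr1 le_max ler_norm.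
apply: le_trans (aS k) _; rewrite exprS.
have rk : 0 <= r ^+ k by rewrite exprn_ge0.
have h1 : rho * a k <= rho * (b * r ^+ k) by rewrite ler_wpM2l.
have h2 : c * r ^+ k <= b * (r - rho) * r ^+ k by rewrite ler_wpM2r.
lra.
Qed.

(** Peel off one factor at a time: the orbit of (A - z) x drives the first-order
    recurrence satisfied by the orbit of x. *)
Lemma root_product_decay n (A : 'M[C]_n.+1) (rho r : R) (s : seq C) :
  0 <= rho -> rho < r -> (forall z, z \in s -> cabs z <= rho) ->
  forall x : 'cV[C]_n.+1,
    horner_mx A (\prod_(z <- s) ('X - z%:P)) *m x = 0 ->
    exists2 c, 0 <= c & forall k i, cabs (iter k (mulmx A) x i 0) <= c * r ^+ k.
Proof.
move=> rho0 rhor; elim: s => [|z s IH] sr x.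
  rewrite big_nil rmorph1 mul1mx => ->; exists 0 => // k i.
  have -> : iter k (mulmx A) (0 : 'cV[C]_n.+1) = 0.
    by elim: k => //= k ->; rewrite mulmx0.
  by rewrite mxE mul0r /ComplexField.Normc.normc /= expr0n addr0 sqrtr0.
rewrite big_cons mulrC rmorphM rmorphB /= horner_mx_X horner_mx_C -mulmxA.
move=> /IH[y ys|c c0 hc]; first by apply: sr; rewrite inE ys orbT.
have iterE k : iter k (mulmx A) ((A - z%:M) *m x) =
    iter k.+1 (mulmx A) x - z *: iter k (mulmx A) x.
  elim: k => [|k IHk]; first by rewrite /= mulmxBl mul_scalar_mx.
  by rewrite iterS IHk mulmxBr -scalemxAr.
have bnd i : exists b, 0 <= b /\
    forall k, cabs (iter k (mulmx A) x i 0) <= b * r ^+ k.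
  suff [b b0 hb] : exists2 b, 0 <= b &
      forall k, cabs (iter k (mulmx A) x i 0) <= b * r ^+ k by exists b.
  apply: (@geometric_recurrence _ rho r c) => // k.
  have -> : iter k.+1 (mulmx A) x i 0 =
      z * iter k (mulmx A) x i 0 + iter k (mulmx A) ((A - z%:M) *m x) i 0.
    rewrite iterE; move: (iter k.+1 _ x) (iter k _ x) => u v.
    by rewrite !mxE [RHS]addrC subrK.
  apply: le_trans (le_normcD _ _) _; rewrite lerD //.
  rewrite ComplexField.Normc.normcM ler_wpM2r ?cabs_ge0 //.
  by apply: sr; rewrite mem_head.
have [b hb] := choice bnd.
exists (\sum_i b i) => [|k i]; first by rewrite sumr_ge0 // => i _; case: (hb i).
apply: le_trans (proj2 (hb i) k) _; rewrite ler_wpM2r ?exprn_ge0 //; first lra.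
by rewrite (bigD1 i) //= lerDl sumr_ge0 // => j _; case: (hb j).
Qed.

(** By Cayley-Hamilton the product of the A - z over the eigenvalues z kills every
    vector, so orbits decay geometrically. *)
Lemma schur_orbit_cvg0 n (F : 'M[R]_n) (x : 'cV[R]_n) : schur F ->
  (fun k => sqnorm (iter k (mulmx F) x)) @ \oo --> (0 : R).
Proof.
case: n F x => [|n] F x sF.
  have -> : (fun k => sqnorm (iter k (mulmx F) x)) = (fun=> 0); last exact: cvg_cst.
  by apply: funext => k; rewrite sqnormE big_ord0.
have [s sE s1] := schur_char_poly sF.
have [rho [rho0 rho1 srho]] : exists rho : R, [/\ 0 <= rho, rho < 1 &
    forall z, z \in s -> cabs z <= rho].
  elim: s s1 {sE} => [|z s IH] s1; first by exists 0.
  case: IH => [y ys|rho [rho0 rho1 hs]]; first by apply: s1; rewrite inE ys orbT.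
  exists (Num.max rho (cabs z)); split; first by rewrite le_max rho0.
    by rewrite gt_max rho1 s1 // mem_head.
  by move=> y; rewrite inE le_max => /orP[/eqP ->|/hs ->//]; rewrite lexx orbT.
pose r := (1 + rho) / 2.
have rhor : rho < r by rewrite /r; lra.
have r1 : r < 1 by rewrite /r; lra.
have r0 : 0 <= r by rewrite /r; lra.
have [|c c0 hc] := @root_product_decay _ (cmx F) rho r s rho0 rhor srho (cmx x).
  by rewrite -sE Cayley_Hamilton mul0mx.
have bound k : sqnorm (iter k (mulmx F) x) <= n.+1%:R * c ^+ 2 * (r ^+ 2) ^+ k.
  have iterE : iter k (mulmx (cmx F)) (cmx x) = cmx (iter k (mulmx F) x).
    by elim: k => //= k ->; rewrite cmxM.
  rewrite sqnormE -mulrA mulr_natl -[X in _ *+ X]card_ord -sumr_const ler_sum // => i _.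
  have := hc k i; rewrite iterE mxE /ComplexField.Normc.normc /= expr0n addr0.
  rewrite sqrtr_sqr => h; rewrite exprAC -exprMn -[leLHS]real_normK ?num_real //.
  rewrite ler_sqr ?nnegrE // mulr_ge0 ?exprn_ge0 //.
apply: (@squeeze_cvgr _ _ _ _ (fun=> 0) (fun k => n.+1%:R * c ^+ 2 * (r ^+ 2) ^+ k)).
- by near=> k; rewrite sqnorm_ge0 bound.
- exact: cvg_cst.
- rewrite -[X in _ --> X](mulr0 (n.+1%:R * c ^+ 2)); apply: cvgM; first exact: cvg_cst.
  apply: cvg_expr; rewrite ger0_norm ?sqr_ge0 // exprn_ilt1.
Unshelve. all: by end_near. Qed.

(** Along an orbit starting where the form is not positive, the form stays below a
    negative constant, yet orbits of a Schur matrix tend to 0. *)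
Lemma lyapunov_posdef n (F P : 'M[R]_n) : schur F -> P^T = P ->
  (forall x, x != 0 -> quad P (F *m x) < quad P x) -> posdef P.
Proof.
move=> sF PT PF; split => // x x0; rewrite ltNge; apply/negP => Px.
pose y k := iter k (mulmx F) (F *m x).
have yle k : quad P (y k) <= quad P (F *m x).
  elim: k => // k IH; rewrite /y iterS -/(y k).
  have [y0|/PF/ltW/le_trans -> //] := eqVneq (y k) 0.
  by rewrite y0 mulmx0 -y0.
have a0 : 0 < - quad P (F *m x) by move: (PF x x0); lra.
pose tau := \sum_i \sum_j `|(- P) i j|.
have tau0 : 0 <= tau by rewrite !sumr_ge0 // => i _; rewrite sumr_ge0.
pose e := - quad P (F *m x) / (tau + 1).
have e0 : 0 < e by rewrite divr_gt0 // ltr_wpDl.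
have eE : e * (tau + 1) = - quad P (F *m x) by rewrite divfK // gt_eqF // ltr_wpDl.
have [k ye] : exists k, sqnorm (y k) < e.
  have /cvgr_lt/(_ e e0) := schur_orbit_cvg0 (F *m x) sF; exact: filter_ex.
have := quad_le_sqnorm (- P) (y k); rewrite quad_mxN -/tau => h.
have := yle k; have : tau * sqnorm (y k) <= tau * e by rewrite ler_wpM2l // ltW.
lra.
Qed.

End SchurStability.

(** * The logarithmic quantizer *)

Section Quantization.
Variables (R : realType) (u0 delta : R).
Hypotheses (u0_gt0 : 0 < u0) (delta01 : 0 < delta < 1).

Let rho := (1 - delta) / (1 + delta).
Local Notation level := (quant_level rho u0).

Let d0 : 0 < delta. Proof. by case/andP: delta01. Qed.
Let d1 : delta < 1. Proof. by case/andP: delta01. Qed.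
Let pd : 0 < 1 + delta. Proof. by move: d0 d1; lra. Qed.
Let md : 0 < 1 - delta. Proof. by move: d0 d1; lra. Qed.
Let rho0 : 0 < rho. Proof. by rewrite divr_gt0. Qed.
Let rho1 : rho < 1. Proof. by rewrite /rho ltr_pdivrMr //; move: d0; lra. Qed.

Lemma density_deltaK : (1 - rho) / (1 + rho) = delta.
Proof. by rewrite /rho; field; rewrite !gt_eqF //; move: pd; lra. Qed.

Lemma level_le i j : (i <= j)%O -> level i <= level j.
Proof.
move=> ij; rewrite /quant_level ler_pM2r // -!exprz_inv ler_eXz2l //.
by rewrite invf_gt1.
Qed.

(** For this density the cells tile the half-line: each ends where the next
    begins. *)
Lemma level_cell i : (1 - delta)^-1 * level i = (1 + delta)^-1 * level (i + 1).
Proof.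
have E : level i = rho * level (i + 1).
  rewrite /quant_level mulrA -{2}[rho]expr1z -expfzDr ?gt_eqF //.
  by congr (_ ^ _ * _); ring.
rewrite E /rho; field; rewrite !gt_eqF //.
Qed.

Let cell v i := (1 + delta)^-1 * level i < v <= (1 - delta)^-1 * level i.

(** The upper ends of the cells tend to +oo and, backwards, to 0; v lies in the
    first cell whose upper end reaches it. *)
Lemma cell_exists v : 0 < v -> exists i, cell v i.
Proof.
move=> v0; pose Q i := v <= (1 - delta)^-1 * level i.
have rho_small e : 0 < e -> exists n, rho ^+ n < e.
  move=> e0; have rn : `|rho| < 1 by rewrite gtr0_norm.
  have /cvgr_lt/(_ e e0) := cvg_expr rn; exact: filter_ex.
have [N QN] : exists N : nat, Q N%:Z.
  have e0 : 0 < (1 - delta)^-1 * u0 / v by rewrite divr_gt0 // mulr_gt0 // invr_gt0.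
  have [N hN] := rho_small _ e0; exists N.
  rewrite /Q /quant_level -exprz_inv -exprnP.
  move: hN; rewrite ltr_pdivlMr // => hN.
  rewrite mulrCA exprVn ler_pdivlMl ?exprn_gt0 //; exact: ltW.
have [M QM] : exists M : nat, ~~ Q (- M%:Z).
  have e0 : 0 < v / ((1 - delta)^-1 * u0) by rewrite divr_gt0 // mulr_gt0 // invr_gt0.
  have [M hM] := rho_small _ e0; exists M.
  rewrite /Q /quant_level opprK -ltNge mulrCA.
  by rewrite -ltr_pdivlMr // mulr_gt0 // invr_gt0.
(* Shifting by M makes the least admissible level one over nat. *)
have ex : exists k : nat, Q (k%:Z - M%:Z).
  by exists (N + M)%N; rewrite PoszD addrK.
have [k Qk kmin] := ex_minnP ex; exists (k%:Z - M%:Z); apply/andP; split => //.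
case: k Qk kmin => [|k] Qk kmin; first by rewrite sub0r (negPf QM) in Qk.
have : ~~ Q (k%:Z - M%:Z) by apply/negP => /kmin; rewrite ltnn.
rewrite /Q -ltNge level_cell.
by have -> : k%:Z - M%:Z + 1 = k.+1%:Z - M%:Z by rewrite -addn1 PoszD; ring.
Qed.

Lemma cell_level_inj v i j : cell v i -> cell v j -> level i = level j.
Proof.
move=> ci cj; suff -> : i = j by [].
wlog ij : i j ci cj / (i < j)%O => [h|].
  by case: (ltgtP i j) => // ij; [apply: h|apply/esym/h].
have : (1 - delta)^-1 * level i <= (1 + delta)^-1 * level j.
  by rewrite level_cell ler_pM2l ?invr_gt0 // level_le // lezD1.
case/andP: ci => _ ci; case/andP: cj => cj _ h.
by have := lt_le_trans cj (le_trans ci h); rewrite ltxx.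
Qed.

Lemma quant_posP v i : cell v i -> quant_pos rho u0 v = level i.
Proof.
move=> ci; rewrite /quant_pos density_deltaK; case: xgetP => [y _ [j [-> h1 h2]]|].
  by apply: (@cell_level_inj v) => //; rewrite /cell h1.
by move=> /(_ (level i)); case; exists i; case/andP: ci.
Qed.

Lemma logquantN v : logquant rho u0 (- v) = - logquant rho u0 v.
Proof.
rewrite /logquant oppr_gt0 oppr_lt0 opprK.
by case: (ltgtP v 0); rewrite ?opprK ?oppr0.
Qed.

(** On a cell the relative error is extremal at the two ends, where it is delta. *)
Lemma logquant_sector v : `|logquant rho u0 v - v| <= delta * `|v|.
Proof.
wlog v0 : v / 0 <= v => [h|].
  case: (lerP 0 v) => [/h//|vneg]; have := h (- v).
  by rewrite logquantN -opprD !normrN; apply; rewrite oppr_ge0 ltW.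
rewrite (ger0_norm v0); have [->|vn0] := eqVneq v 0.
  by rewrite /logquant ltxx subr0 normr0 mulr0.
have {vn0}v0 : 0 < v by rewrite lt_neqAle eq_sym vn0.
have [i ci] := cell_exists v0; rewrite /logquant v0 (quant_posP ci).
case/andP: ci; rewrite ltr_pdivrMl // ler_pdivlMl // => h1 h2.
by rewrite ler_norml; lra.
Qed.

(** A positive scaling moves v to the point of the cell of level 0 whose ratio to
    the level is prescribed.  The slope 1 + delta is missed, because the lower end
    of a cell is excluded. *)
Lemma logquant_slope v D : v != 0 -> - delta <= D < delta ->
  exists2 t, 0 < t & logquant rho u0 (t * v) = (1 + D) * (t * v).
Proof.
move=> v0 /andP[D1 D2].
have Dp : 0 < 1 + D by move: md; lra.
exists (u0 / ((1 + D) * `|v|)); first by rewrite divr_gt0 // mulr_gt0 // normr_gt0.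
wlog vp : v v0 / 0 < v => [h|].
  case: (ltgtP v 0) v0 => // vneg _; last by apply: h => //; rewrite gt_eqF.
  have := h (- v); rewrite oppr_eq0 lt_eqF // oppr_gt0 normrN mulrN logquantN mulrN.
  by move=> /(_ isT vneg)/oppr_inj.
rewrite gtr0_norm //; set w := _ / _ * v.
have wE : (1 + D) * w = u0 by rewrite /w; field; rewrite !gt_eqF.
have w0 : 0 < w by rewrite -(pmulr_rgt0 _ Dp) wE.
have lev0 : level 0 = u0 by rewrite /quant_level oppr0 expr0z mul1r.
rewrite /logquant w0 wE (@quant_posP _ 0) ?lev0 //; apply/andP.
rewrite lev0 ltr_pdivrMl // ler_pdivlMl // -wE; split; nra.
Qed.

End Quantization.

(** * One system: quadratic stability and gain *)

Section SingleSystem.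
Variable R : realType.
Local Notation C := R[i].
Local Notation cabs := (@ComplexField.Normc.normc R).
Local Notation re := (@complex.Re R).
Local Notation im := (@complex.Im R).

Lemma sqnorm_col_mx1 n (x : 'cV[R]_n) (p : R) :
  sqnorm (col_mx x p%:M : 'cV_(n + 1)) = sqnorm x + p ^+ 2.
Proof.
by rewrite /sqnorm tr_col_mx mul_row_col tr_scalar_mx -scalar_mxM !mxE eqxx mulr1n expr2.
Qed.

Lemma quad_diag_block n m (M : 'M[R]_n) (N : 'M[R]_m) x y :
  quad (block_mx M 0 0 N) (col_mx x y) = quad M x + quad N y.
Proof.
rewrite /quad tr_col_mx mul_row_block !mulmx0 addr0 add0r mul_row_col.
exact: addmxE.
Qed.

Lemma sqnorm_scalar (p : R) : sqnorm (p%:M : 'cV_1) = p ^+ 2.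
Proof. by rewrite sqnormE big_ord1 mxE eqxx mulr1n. Qed.

(** The inequality is the strict feasibility, in P, of
    E' P E - J' P J + diag(K' K, -1) < 0 with E = [F B] and J = [I 0]; the
    frequency bound excludes the dual solution.  Strictness gives the margin c,
    and p = 0 gives a Lyapunov inequality for F, hence P > 0. *)
Lemma bounded_real n (F : 'M[R]_n) (B : 'cV[R]_n) (K : 'rV[R]_n) :
  schur F -> (forall z, cabs z = 1 -> cabs (siso_gain F B K z) < 1) ->
  exists P : 'M[R]_n, posdef P /\ exists2 c, 0 < c & forall x p,
    quad P (F *m x + p *: B)
      <= quad P x - ((K *m x) 0 0) ^+ 2 + p ^+ 2 - c * sqnorm x.
Proof.
move=> sF gF.
pose E := row_mx F B; pose J : 'M[R]_(n, n + 1) := row_mx 1%:M 0.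
pose D : 'M[R]_(n + 1) := block_mx (K^T *m K) 0 0 (- 1%:M).
have DT : D^T = D.
  by rewrite tr_block_mx !trmx0 trmx_mul trmxK linearN /= trmx1.
have [[P [PT Plt]]|[W [Wpos trW EWJ DW]]] := stein_alternative E J DT; last first.
  have W0 := stein_solution_eq0 sF gF Wpos EWJ DW.
  by move: trW; rewrite W0 mxtrace0 => /esym/eqP; rewrite oner_eq0.
pose M := - (E^T *m P *m E - J^T *m P *m J + D).
have Mpos : posdef M.
  split => [|v v0]; last by rewrite quad_mxN oppr_gt0 Plt.
  rewrite /M linearN /= linearD /= linearB /= DT !trmx_mul !trmxK PT.
  by rewrite !mulmxA.
have [c c0 cM] := sqnorm_le_posdef Mpos.
have ineq x p : quad P (F *m x + p *: B)
      <= quad P x - ((K *m x) 0 0) ^+ 2 + p ^+ 2 - c * sqnorm x.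
  have := cM (col_mx x p%:M); rewrite sqnorm_col_mx1.
  have -> : quad M (col_mx x p%:M) = - (quad P (F *m x + p *: B) - quad P x
      + (((K *m x) 0 0) ^+ 2 - p ^+ 2)).
    rewrite quad_mxN 2!quad_mxD quad_mxN !quad_congr !mul_row_col mul1mx mul0mx addr0.
    rewrite mul_mx_scalar; congr (- (_ - _ + _)).
    rewrite quad_diag_block quad_mxN quad1 sqnorm_scalar -[K^T]mulmx1 quad_congr quad1.
    by rewrite sqnormE big_ord1.
  have : 0 <= c * p ^+ 2 by rewrite mulr_ge0 ?sqr_ge0 // ltW.
  lra.
exists P; split; last by exists c.
apply: (lyapunov_posdef sF PT) => x x0.
have := ineq x 0; rewrite scale0r addr0 => h.
have : 0 < c * sqnorm x by rewrite mulr_gt0 // sqnorm_gt0.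
have := sqr_ge0 ((K *m x) 0 0); move: h; rewrite expr0n /=; lra.
Qed.

Lemma transferE n (A : 'M[R]_n) B K z :
  transfer A B K z = siso_gain (A + B *m K) B K z.
Proof. by rewrite /transfer /siso_gain cmxD cmxM opprD addrA. Qed.

Lemma siso_gainZ n (F : 'M[R]_n) B K (d : R) z :
  siso_gain F B (d *: K) z = d%:C%C * siso_gain F B K z.
Proof.
rewrite /siso_gain; have -> : cmx (d *: K) = d%:C%C *: cmx K.
  by apply/matrixP => i j; rewrite !mxE rmorphM.
by rewrite -!scalemxAl mxE.
Qed.

Lemma cabsR (d : R) : cabs d%:C%C = `|d|.
Proof. by rewrite /ComplexField.Normc.normc /= expr0n addr0 sqrtr_sqr. Qed.

(** Apply the bounded real lemma to the output delta K x and take for p the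
    quantization error, which the sector bound keeps below delta |K x|. *)
Lemma quantized_stabilizes_of_gain n (A : 'M[R]_n) B K (u0 delta : R) :
  0 < u0 -> 0 < delta < 1 -> schur (A + B *m K) ->
  (forall z, cabs z = 1 -> delta * cabs (transfer A B K z) < 1) ->
  quantized_stabilizes ((1 - delta) / (1 + delta)) u0 B K A.
Proof.
move=> u0p d01 sF gF; have /andP[d0 d1] := d01.
have [z z1|P [Ppos [c c0 ineq]]] := @bounded_real n (A + B *m K) B (delta *: K) sF.
  by rewrite siso_gainZ ComplexField.Normc.normcM cabsR gtr0_norm // -transferE gF.
exists P, c; split => // x.
set v := (K *m x) 0 0; set f := logquant _ _ _.
have -> : A *m x + f *: B = (A + B *m K) *m x + (f - v) *: B.
  have KxE : K *m x = v%:M := mx11_scalar _.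
  by rewrite mulmxDl -mulmxA KxE mul_mx_scalar scalerBl -addrA (addrC (v *: B)) subrK.
have := ineq x (f - v).
have -> : ((delta *: K) *m x) 0 0 = delta * v by rewrite -scalemxAl mxE.
have : (f - v) ^+ 2 <= (delta * v) ^+ 2.
  rewrite -[leLHS]real_normK ?num_real // -[leRHS]real_normK ?num_real //.
  rewrite ler_sqr ?nnegrE // normrM (gtr0_norm d0); exact: logquant_sector.
by rewrite -/(sqnorm x) mulNr; lra.
Qed.

Lemma cabs_sqr (z : C) : cabs z ^+ 2 = re z ^+ 2 + im z ^+ 2.
Proof. by case: z => a b; rewrite sqr_sqrtr // addr_ge0 ?sqr_ge0. Qed.

(** The Hermitian form x^H P x, for a real symmetric P. *)
Definition quadC n (P : 'M[R]_n) (x : 'cV[C]_n) : R :=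
  quad P (Remx x) + quad P (Immx x).

Lemma quadCZ n (P : 'M[R]_n) z (x : 'cV[C]_n) : P^T = P ->
  quadC P (z *: x) = cabs z ^+ 2 * quadC P x.
Proof.
move=> PT; rewrite cabs_sqr /quadC.
have -> : Remx (z *: x) = re z *: Remx x + (- im z) *: Immx x.
  by apply/matrixP => i j; rewrite !mxE; case: z (x i j) => a b [c e] /=; ring.
have -> : Immx (z *: x) = im z *: Remx x + re z *: Immx x.
  by apply/matrixP => i j; rewrite !mxE; case: z (x i j) => a b [c e] /=; ring.
have bZl a u v : bilin P (a *: u) v = a * bilin P u v.
  by rewrite bilinC // bilinZr bilinC.
by rewrite !quadD // !quadZ !bilinZr !bZl; ring.
Qed.

(** Take for zeta a square root of i conj(h) / |h|. *)
Lemma phase_to_imaginary (h : C) :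
  exists2 zeta : C, cabs zeta = 1 & re (zeta ^+ 2 * h) = 0.
Proof.
have [->|h0] := eqVneq h 0.
  by exists 1; rewrite ?mulr0 //; apply/cabs1; exact: normr1.
have nh0 : `|h| != 0 by rewrite normr_eq0.
pose t : C := 'i%C * conjc h / `|h|.
have th : t * h = 'i%C * `|h|.
  rewrite /t mulrAC -(mulrA 'i%C) (mulrC (conjc h)) -sqr_normc expr2.
  by rewrite mulrA mulfK.
exists (sqrtc t); last by rewrite sqr_sqrtc th normE /= mul0r mulr0 subr0.
apply/cabs1/eqP; rewrite -sqrp_eq1 // -normrX sqr_sqrtc /t !normrM normfV normr_id.
by rewrite normcJ complexiE normCi mul1r divff.
Qed.

Lemma char_poly_trmx n (A : 'M[C]_n) : char_poly A^T = char_poly A.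
Proof.
rewrite /char_poly -[RHS]det_tr; congr (\det _).
by rewrite /char_poly_mx linearB /= tr_scalar_mx map_trmx.
Qed.

(** Lossless S-procedure at a single frequency.  Let xi be the response at z to the
    unit input, with output g, and suppose d |g| >= 1.  For a phase zeta the real
    and imaginary parts (x, p) of (zeta xi, zeta) have the same total value
    (d |g|)^2 - 1 >= 0 of the form (d K x)^2 - p^2, and by the choice of zeta each
    takes half of it.  Hence p = D K x with |D| <= d for each part, and both lose
    P-energy; but multiplication by z preserves the total. *)
Lemma gain_lt_of_quadratic_stability n (F : 'M[R]_n) (B : 'cV[R]_n)
    (K : 'rV[R]_n) (P : 'M[R]_n) (d eps : R) :
  0 <= d -> posdef P -> 0 < eps ->
  (forall x D, - d <= D <= d ->
     quad P ((F + D *: (B *m K)) *m x) - quad P x <= - eps * sqnorm x) ->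
  schur F /\ forall z, cabs z = 1 -> d * cabs (siso_gain F B K z) < 1.
Proof.
move=> d0 Ppos eps0 stab; have [PT _] := Ppos.
have quadC_ge0 x : 0 <= quadC P x by rewrite addr_ge0 // posdef_ge0.
have sF : schur F.
  move=> z zF; rewrite ltNge; apply/negP => z1.
  have : eigenvalue (cmx F)^T z.
    by rewrite eigenvalue_root_char char_poly_trmx -eigenvalue_root_char.
  case/eigenvalueP => v vF v0; pose x := v^T.
  have Fx : cmx F *m x = z *: x by rewrite -[cmx F]trmxK -trmx_mul vF linearZ.
  have st y : quad P (F *m y) - quad P y <= - eps * sqnorm y.
    by have := stab y 0; rewrite scale0r addr0; apply; rewrite oppr_le0 d0.
  have := quadCZ z x PT; rewrite -Fx /quadC Remx_cmxM Immx_cmxM.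
  rewrite -/(quadC P x) => E.
  have z2 : 1 <= cabs z ^+ 2 by rewrite exprn_ege1.
  have := st (Remx x); have := st (Immx x) => h1 h2.
  have h3 : quadC P x <= cabs z ^+ 2 * quadC P x by rewrite ler_peMl.
  have : 0 < sqnorm (Remx x) + sqnorm (Immx x).
    rewrite lt_neqAle addr_ge0 ?sqnorm_ge0 // andbT eq_sym.
    rewrite paddr_eq0 ?sqnorm_ge0 //; apply/negP.
    move=> /andP[/eqP/sqnorm_eq0 xr /eqP/sqnorm_eq0 xi].
    case/negP: v0; rewrite -trmx_eq0 -/x; apply/eqP/matrixP => i j.
    move/matrixP/(_ i j): xr; move/matrixP/(_ i j): xi; rewrite !mxE.
    by case: (v j i) => a b /= -> ->.
  move=> /(mulr_gt0 eps0); move: h1 h2 h3 E; rewrite /quadC; lra.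
split => // z z1; rewrite ltNge; apply/negP => gz.
set g := siso_gain F B K z in gz.
pose xi := invmx (z%:M - cmx F) *m cmx B.
have xiE : z *: xi = cmx F *m xi + cmx B.
  have := mulKVmx (schur_unit sF z1) (cmx B); rewrite -/xi mulmxBl mul_scalar_mx.
  by move=> <-; rewrite addrC subrK.
have Kxi : cmx K *m xi = g%:M.
  by apply/matrixP => i j; rewrite !ord1 [RHS]mxE eqxx mulr1n mulmxA.
have [zeta zeta1 zetah] := phase_to_imaginary ((d%:C%C * g) ^+ 2 - 1).
pose x := zeta *: xi; pose gz' := zeta * g.
have xE : z *: x = cmx F *m x + zeta *: cmx B.
  by rewrite /x scalerA mulrC -scalerA xiE scalerDr scalemxAr.
have KRe : (K *m Remx x) 0 0 = re gz'.
  by rewrite -Remx_cmxM /x -scalemxAr Kxi !mxE eqxx mulr1n.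
have KIm : (K *m Immx x) 0 0 = im gz'.
  by rewrite -Immx_cmxM /x -scalemxAr Kxi !mxE eqxx mulr1n.
(* The two parts have equal shares of the form: their difference is the real part
   of zeta^2 ((d g)^2 - 1). *)
have diff : d ^+ 2 * re gz' ^+ 2 - re zeta ^+ 2 = d ^+ 2 * im gz' ^+ 2 - im zeta ^+ 2.
  apply/eqP; rewrite -subr_eq0 -zetah /gz'; apply/eqP.
  by case: (zeta) (g) => a b [c e] /=; ring.
have sum : 0 <= (d ^+ 2 * re gz' ^+ 2 - re zeta ^+ 2) +
    (d ^+ 2 * im gz' ^+ 2 - im zeta ^+ 2).
  have e1 : cabs zeta ^+ 2 = 1 by rewrite zeta1 expr1n.
  have e2 : 1 <= (d * cabs gz') ^+ 2.
    by rewrite exprn_ege1 // /gz' ComplexField.Normc.normcM zeta1 mul1r.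
  by move: e1 e2; rewrite exprMn !cabs_sqr; lra.
(* A real pair in the sector comes from a real perturbation; when K y = 0 the
   sector forces p = 0 and any slope will do. *)
have step (y : 'cV[R]_n) p : p ^+ 2 <= d ^+ 2 * ((K *m y) 0 0) ^+ 2 ->
    quad P (F *m y + p *: B) - quad P y <= - eps * sqnorm y.
  set k := (K *m y) 0 0 => pk.
  have KyE : K *m y = k%:M := mx11_scalar _.
  have [D Dd pE] : exists2 D, - d <= D <= d & p = D * k.
    have [k0|k0] := eqVneq k 0.
      exists 0; first by rewrite oppr_le0 d0.
      rewrite mul0r; apply/eqP; rewrite -sqrf_eq0 eq_le sqr_ge0 andbT.
      by move: pk; rewrite k0 expr0n mulr0.
    exists (p / k); last by rewrite divfK.
    rewrite -ler_norml normrM normfV ler_pdivrMr ?normr_gt0 //.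
    rewrite -ler_sqr ?nnegrE ?mulr_ge0 // exprMn !real_normK ?num_real //.
  have := stab y D Dd; rewrite mulmxDl -scalemxAl -mulmxA KyE mul_mx_scalar.
  by rewrite scalerA -pE.
have := step (Remx x) (re zeta); rewrite KRe => /(_ ltac:(lra)) s1.
have := step (Immx x) (im zeta); rewrite KIm => /(_ ltac:(lra)) s2.
have := quadCZ z x PT; rewrite z1 expr1n mul1r xE /quadC.
have -> : Remx (cmx F *m x + zeta *: cmx B) = F *m Remx x + re zeta *: B.
  rewrite -Remx_cmxM; apply/matrixP => i j; rewrite !mxE.
  by case: (zeta) (\sum_k _) => a b [c e] /=; ring.
have -> : Immx (cmx F *m x + zeta *: cmx B) = F *m Immx x + im zeta *: B.
  rewrite -Immx_cmxM; apply/matrixP => i j; rewrite !mxE.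
  by case: (zeta) (\sum_k _) => a b [c e] /=; ring.
move=> E.
have r0 := sqnorm_ge0 (Remx x); have i0 := sqnorm_ge0 (Immx x).
have ss : eps * (sqnorm (Remx x) + sqnorm (Immx x)) <= 0 by lra.
have xr : sqnorm (Remx x) = 0 by nra.
have xi0 : sqnorm (Immx x) = 0 by nra.
move: KRe KIm; rewrite (sqnorm_eq0 xr) (sqnorm_eq0 xi0) !mulmx0 !mxE => kr ki.
have := cabs_sqr zeta; rewrite zeta1 expr1n.
move: diff sum; rewrite -kr -ki expr0n mulr0.
by have := sqr_ge0 (re zeta); have := sqr_ge0 (im zeta); lra.
Qed.

End SingleSystem.

(** * Robustness of quadratic stability *)

Section Margin.
Variable R : realType.
Local Notation C := R[i].
Local Notation cabs := (@ComplexField.Normc.normc R).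

(** By homogeneity of the quadratic inequality, a state can first be rescaled so
    that the quantizer acts on it with the slope 1 + D. *)
Lemma quantized_sector_stability n (A : 'M[R]_n) B K (P : 'M[R]_n) (u0 delta eps : R) :
  0 < u0 -> 0 < delta < 1 ->
  (forall x, quad P (A *m x + logquant ((1 - delta) / (1 + delta)) u0 ((K *m x) 0 0) *: B)
       - quad P x <= - eps * sqnorm x) ->
  forall x D, - delta <= D < delta ->
    quad P ((A + B *m K + D *: (B *m K)) *m x) - quad P x <= - eps * sqnorm x.
Proof.
move=> u0p d01 st x D Dd; set v := (K *m x) 0 0.
have KxE : K *m x = v%:M := mx11_scalar _.
have yE : (A + B *m K + D *: (B *m K)) *m x = A *m x + ((1 + D) * v) *: B.
  rewrite !mulmxDl -scalemxAl -mulmxA KxE mul_mx_scalar scalerA -addrA -scalerDl.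
  by rewrite mulrDl mul1r.
have [v0|v0] := eqVneq v 0.
  by have := st x; rewrite -/v yE v0 mulr0 /logquant ltxx.
have [t t0 ft] := logquant_slope u0p d01 v0 Dd.
have := st (t *: x); rewrite -scalemxAr -scalemxAr mxE -/v ft.
have -> : t *: (A *m x) + ((1 + D) * (t * v)) *: B =
    t *: ((A + B *m K + D *: (B *m K)) *m x).
  by rewrite yE scalerDr scalerA; congr (_ + _ *: _); ring.
rewrite !quadZ sqnormZ -mulrBr mulrCA ler_pM2l // exprn_gt0 //.
Qed.

(** Young's inequality for the P-inner product: the form is nonnegative at
    s x - y. *)
Lemma quad_add_le n (P : 'M[R]_n) (x y : 'cV[R]_n) s : posdef P -> 0 < s ->
  quad P (x + y) <= (1 + s) * quad P x + (1 + s^-1) * quad P y.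
Proof.
move=> Ppos s0; have [PT _] := Ppos.
have := posdef_ge0 (s *: x + (-1) *: y) Ppos.
rewrite !quadD // !quadZ !bilinZr (bilinC _ y PT) bilinZr (bilinC y x PT) => h.
set q := (X in 0 <= X) in h.
have : 0 <= s^-1 * q by rewrite mulr_ge0 // invr_ge0 ltW.
have -> : s^-1 * q = s * quad P x - 2 * bilin P x y + s^-1 * quad P y.
  by rewrite /q; field; rewrite gt_eqF.
lra.
Qed.

(** D is clamped to an inner sector, where the hypothesis applies; what remains,
    E plus the excess of D times B', is a perturbation J with small entries.
    Young's inequality charges it partly to the form at x, with a small weight s,
    and partly to the form at J x, which is small with J. *)
Lemma sector_stability_margin n (F B' P : 'M[R]_n) (delta eps : R) :
  0 < delta -> posdef P -> 0 < eps ->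
  (forall x D, - delta <= D < delta ->
     quad P ((F + D *: B') *m x) - quad P x <= - eps * sqnorm x) ->
  exists e : R, [/\ 0 < e, e < delta & forall (E : 'M[R]_n) D x,
    (forall i j, `|E i j| < e) -> `|D| <= delta + e ->
    quad P ((F + E + D *: B') *m x) - quad P x <= - (eps / 2) * sqnorm x].
Proof.
move=> d0 Ppos eps0 st.
pose tau := \sum_i \sum_j `|P i j|.
have tau0 : 0 <= tau by rewrite !sumr_ge0 // => i _; rewrite sumr_ge0.
(* Half of the decrease eps is spent, eps / 4 on each term of Young's inequality:
   s is the weight of the first and b bounds the form at J x in the second. *)
pose s := eps / (4 * (tau + 1)).
have s0 : 0 < s by rewrite divr_gt0 // mulr_gt0 // ltr_wpDl.
have stau : s * tau <= eps / 4.
  have -> : eps / 4 = s * (tau + 1) by rewrite /s; field; rewrite !gt_eqF //; lra.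
  by rewrite ler_pM2l //; lra.
pose b := eps / (4 * (1 + s^-1)).
have s10 : 0 < 1 + s^-1 by rewrite ltr_wpDl // invr_gt0.
have b0 : 0 < b by rewrite divr_gt0 // mulr_gt0.
have bE : (1 + s^-1) * b = eps / 4.
  by rewrite /b; field; rewrite !gt_eqF //; move: s10; lra.
pose h (J : 'M[R]_n) := \sum_i \sum_j `|(J^T *m P *m J) i j|.
have ch : h @ nbhs (0 : 'M[R]_n) --> h 0.
  apply: (@cvg_sumr _ _ _ (nbhs (0 : 'M[R]_n))) => i.
  apply: (@cvg_sumr _ _ _ (nbhs (0 : 'M[R]_n))) => j.
  apply: cvg_norm; apply: (@cvg_entry _ _ (nbhs (0 : 'M[R]_n))).
  apply: cvg_mulmx; last exact: cvg_id.
  apply: cvg_mulmx; last exact: cvg_cst.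
  by apply: cvg_trmx; exact: cvg_id.
have h0 : h 0 = 0.
  by rewrite /h big1 // => i _; rewrite big1 // => j _; rewrite mulmx0 mxE normr0.
have : \forall J \near (0 : 'M[R]_n), h J < b.
  by apply: (cvgr_lt _ ch); rewrite h0.
move=> /nbhs_ballP[r /= r0 hr].
pose beta := 1 + \sum_i \sum_j `|B' i j|.
have beta1 : 1 <= beta.
  by rewrite lerDl !sumr_ge0 // => i _; rewrite sumr_ge0.
pose e := Num.min (delta / 2) (r / (4 * beta)).
have e0 : 0 < e by rewrite lt_min !divr_gt0 ?mulr_gt0 //; lra.
have ed : e <= delta / 2 by rewrite ge_min lexx.
have er : e * (4 * beta) <= r.
  by rewrite -ler_pdivlMr ?ge_min ?lexx ?orbT // mulr_gt0 //; lra.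
exists e; split => //; first lra.
move=> E D x Ee De.
(* The inner sector stops e short of delta, away from the excluded slope. *)
have [D0 D0d DD] : exists2 D0, - delta <= D0 < delta & `|D - D0| <= 2 * e.
  move: De; rewrite ler_norml => /andP[De1 De2].
  have [D1|D1] := ltrP D (- (delta - e)).
    exists (- (delta - e)); first by apply/andP; split; lra.
    by rewrite ler_norml; apply/andP; split; lra.
  have [D2|D2] := ltrP (delta - e) D.
    exists (delta - e); first by apply/andP; split; lra.
    by rewrite ler_norml; apply/andP; split; lra.
  exists D; first by apply/andP; split; lra.
  by rewrite subrr normr0; lra.
pose J := E + (D - D0) *: B'.
have hJ : h J < b.
  apply: hr; split => // i j; rewrite /ball /= [X in X - _]mxE sub0r normrN /J !mxE.
  have B'le : `|B' i j| <= beta - 1.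
    rewrite /beta (addrC 1) addrK (bigD1 i) //= (bigD1 j) //= -addrA lerDl.
    by rewrite addr_ge0 // ?sumr_ge0 // => k _; rewrite sumr_ge0.
  apply: le_lt_trans (ler_normD _ _) _; rewrite normrM.
  have h1 : `|D - D0| * `|B' i j| <= 2 * e * (beta - 1) by rewrite ler_pM.
  have := Ee i j; move: h1 er; nra.
have -> : (F + E + D *: B') *m x = (F + D0 *: B') *m x + J *m x.
  rewrite -mulmxDl /J; congr (_ *m _); rewrite scalerBl addrACA -addrA.
  by rewrite [D0 *: B' + _]addrC subrK addrA.
have q1 := quad_add_le ((F + D0 *: B') *m x) (J *m x) Ppos s0.
have q2 := st x D0 D0d.
have q3 : quad P (J *m x) <= b * sqnorm x.
  rewrite -quad_congr; apply: le_trans (quad_le_sqnorm _ _) _.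
  by rewrite ler_wpM2r ?sqnorm_ge0 // ltW.
have q4 : quad P x <= tau * sqnorm x := quad_le_sqnorm P x.
have x0 := sqnorm_ge0 x.
have q5 : (1 + s^-1) * quad P (J *m x) <= eps / 4 * sqnorm x.
  by rewrite -bE -mulrA ler_pM2l.
have q6 : s * quad P ((F + D0 *: B') *m x) <= eps / 4 * sqnorm x.
  apply: (le_trans (y := s * (tau * sqnorm x))).
    by rewrite ler_pM2l //; have := mulr_ge0 (ltW eps0) x0; lra.
  by rewrite mulrA ler_wpM2r.
lra.
Qed.

Lemma gain_lt_near n (A : 'M[R]_n) B K (u0 delta : R) :
  0 < u0 -> 0 < delta < 1 ->
  quantized_stabilizes ((1 - delta) / (1 + delta)) u0 B K A ->
  \forall A' \near A & d \near delta,
    schur (A' + B *m K) /\ forall z, cabs z = 1 -> d * cabs (transfer A' B K z) < 1.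
Proof.
move=> u0p d01 [P [eps [Ppos eps0 st]]]; have /andP[d0 d1] := d01.
have sec := quantized_sector_stability u0p d01 st.
have [e [e0 ed marg]] := sector_stability_margin d0 Ppos eps0 sec.
exists (ball A e, ball delta e); first by split; exact: nbhsx_ballx.
move=> [A' d] /= [[_ AA'] dd].
have [dge dle] : 0 <= d /\ d <= delta + e.
  by move: dd; rewrite /ball /= ltr_norml => /andP[]; split; lra.
have eps2 : 0 < eps / 2 by lra.
suff stab : forall x D, - d <= D <= d ->
    quad P ((A' + B *m K + D *: (B *m K)) *m x) - quad P x <= - (eps / 2) * sqnorm x.
  have [sF gF] := gain_lt_of_quadratic_stability dge Ppos eps2 stab.
  by split => // z z1; rewrite transferE; exact: gF.
move=> x D; rewrite -ler_norml => Dd.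
have -> : A' + B *m K = A + B *m K + (A' - A) by rewrite [RHS]addrC addrA subrK.
apply: marg; last exact: le_trans dle.
by move=> i j; rewrite !mxE distrC; exact: AA'.
Qed.

End Margin.

(** * The set of consistent systems *)

Section ConsistentSet.
Variables (R : realType) (n T : nat).
Local Notation C := R[i].
Local Notation cabs := (@ComplexField.Normc.normc R).
Implicit Types (Phi : 'M[R]_(n + T)) (B : 'cV[R]_n) (x : nat -> 'cV[R]_n) (u : nat -> R).

(** The constraint sees A only through A X_-, that is, through the noise
    X_U - A X_- that A would need to explain the data. *)
Lemma consistent_setE (Phi : 'M[R]_(n + T)) B x u A :
  consistent_set Phi B x u A <->
  qmi Phi (data_XU T B x u - A *m data_Xminus T x).
Proof.
rewrite /consistent_set /qmi /=; set D := block_mx _ _ _ _.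
have <- : D^T *m col_mx 1%:M A^T =
    col_mx 1%:M (data_XU T B x u - A *m data_Xminus T x)^T.
  rewrite /D tr_block_mx mul_block_col trmx0 mul0mx addr0 !mulmx1 trmx1.
  by rewrite -trmx_mul mulmxN -linearD.
by rewrite trmx_mul trmxK !mulmxA.
Qed.

Lemma true_system_consistent Phi (As : 'M[R]_n) B x u (w : nat -> 'cV[R]_n) :
  (forall k, (k < T)%N -> x k.+1 = As *m x k + u k *: B + w k) ->
  qmi Phi (data_W T w) -> consistent_set Phi B x u As.
Proof.
move=> dyn qW; apply/consistent_setE; suff -> : data_XU T B x u - As *m data_Xminus T x
    = data_W T w by [].
apply/matrixP => i k; rewrite !mxE big_ord1 dyn // !mxE.
under [X in _ - X]eq_bigr do rewrite mxE.
rewrite (mulrC (B i 0)); ring.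
Qed.

Lemma consistent_set_free_direction Phi B x u (A : 'M[R]_n) (eta : 'rV[R]_n) t :
  eta *m data_Xminus T x = 0 -> consistent_set Phi B x u A ->
  consistent_set Phi B x u (A + t *: (eta^T *m eta)).
Proof.
move=> eta0 /consistent_setE h; apply/consistent_setE.
by rewrite mulmxDl -scalemxAl -mulmxA eta0 mulmx0 scaler0 addr0.
Qed.

(** A row eta with eta X_- = 0 makes A + t eta' eta consistent for every t, but its
    trace grows linearly with t whereas the trace of a Schur matrix is at most n. *)
Lemma row_free_data Phi B x u (A : 'M[R]_n) (K : 'rV[R]_n) :
  consistent_set Phi B x u A ->
  (forall A', consistent_set Phi B x u A' -> schur (A' + B *m K)) ->
  row_free (data_Xminus T x).
Proof.
move=> SA sch; rewrite -kermx_eq0; apply/eqP/row_matrixP => i; rewrite row0.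
apply/eqP; rewrite -[_ == 0]negbK; apply/negP => eta_neq0.
set eta := row i _ in eta_neq0.
have eta0 : eta *m data_Xminus T x = 0 by rewrite -row_mul mulmx_ker row0.
have q0 : 0 < sqnorm eta^T by rewrite sqnorm_gt0 // trmx_eq0.
set q := sqnorm _ in q0; pose a := \tr (A + B *m K).
(* This t makes the trace equal to n + 1. *)
pose t := (n%:R + 1 - a) / q.
have := schur_trace_le (sch _ (consistent_set_free_direction t eta0 SA)).
have -> : A + t *: (eta^T *m eta) + B *m K = A + B *m K + t *: (eta^T *m eta).
  by rewrite addrAC.
rewrite linearD /= mxtraceZ -/a -{2}[eta]trmxK -[_ *m _]mul1mx mxtrace_rank1 quad1.
rewrite -/q /t divfK ?gt_eqF // addrC subrK ger0_norm ?addr_ge0 //.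
by rewrite gerDl ler10.
Qed.

(** Evaluate the inequality at the i-th basis vector: with v the i-th row of Z,
    half of the negative definite term -c |v|^2 absorbs the part of the cross term
    that depends on Z. *)
Lemma qmi_bounded (Phi11 : 'M[R]_n) (Phi12 : 'M[R]_(n, T)) (Phi22 : 'M[R]_T) :
  negdef Phi22 -> exists b, forall Z : 'M[R]_(n, T),
    qmi (block_mx Phi11 Phi12 Phi12^T Phi22) Z -> forall i j, `|Z i j| <= b.
Proof.
move=> [PT Pneg].
have Npos : posdef (- Phi22).
  by split => [|v v0]; [rewrite linearN /= PT|rewrite quad_mxN oppr_gt0 Pneg].
have [c c0 cN] := sqnorm_le_posdef Npos.
pose w i := Phi12^T *m (delta_mx i 0 : 'cV[R]_n).
pose r i := `|Phi11 i i| + (2 / c) * sqnorm (w i).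
have r0 i : 0 <= r i.
  by rewrite addr_ge0 // mulr_ge0 ?sqnorm_ge0 // divr_ge0 // ltW.
exists (1 + (2 / c) * \sum_i r i) => Z [_ qZ] i j.
pose y : 'cV[R]_n := delta_mx i 0; pose v := Z^T *m y.
have vE k : v k 0 = Z i k by rewrite /v /y -colE !mxE.
have qE : quad (block_mx Phi11 Phi12 Phi12^T Phi22) (col_mx y v) =
    quad Phi11 y + 2 * bilin 1%:M (w i) v + quad Phi22 v.
  rewrite /quad /bilin tr_col_mx mul_row_block mul_row_col !mulmxDl !addmxE mulmx1.
  have -> : (w i)^T = y^T *m Phi12 by rewrite trmx_mul trmxK.
  have -> : (v^T *m Phi12^T *m y) 0 0 = (y^T *m Phi12 *m v) 0 0.
    have -> : v^T *m Phi12^T *m y = (y^T *m Phi12 *m v)^T.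
      by rewrite [RHS]trmx_mul (trmx_mul y^T) trmxK mulmxA.
    by rewrite mxE.
  ring.
have h1 : 0 <= quad Phi11 y + 2 * bilin 1%:M (w i) v + quad Phi22 v.
  rewrite -qE; have := qZ y; rewrite quad_congr mul_col_mx mul1mx //.
have h2 := cN v; rewrite quad_mxN in h2.
have pos1 : posdef (1%:M : 'M[R]_T).
  by split => [|z z0]; [exact: trmx1|rewrite quad1 sqnorm_gt0].
have h3 : 2 * bilin 1%:M (w i) v <= (2 / c) * sqnorm (w i) + c / 2 * sqnorm v.
  have := posdef_ge0 ((2 / c) *: w i + (-1) *: v) pos1.
  rewrite quadD ?trmx1 // !quadZ bilinZr (bilinC _ v) ?trmx1 // bilinZr.
  rewrite (bilinC v) ?trmx1 // !quad1 => h.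
  have := mulr_ge0 (ltW c0) h.
  have -> : c * ((2 / c) ^+ 2 * sqnorm (w i) + 2 * (-1 * (2 / c * bilin 1%:M (w i) v))
     + (-1) ^+ 2 * sqnorm v) = 2 * ((2 / c) * sqnorm (w i) - 2 * bilin 1%:M (w i) v
      + c / 2 * sqnorm v) by field; rewrite gt_eqF.
  lra.
have h4 : quad Phi11 y <= `|Phi11 i i|.
  by rewrite /quad /y trmx_delta -rowE -colE !mxE ler_norm.
have h5 : sqnorm v <= (2 / c) * r i.
  rewrite mulrAC ler_pdivlMr // /r; lra.
have h6 : Z i j ^+ 2 <= sqnorm v.
  rewrite sqnormE (bigD1 j) //= vE lerDl sumr_ge0 // => k _; exact: sqr_ge0.
have h7 : (2 / c) * r i <= (2 / c) * \sum_i r i.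
  by rewrite ler_wpM2l ?divr_ge0 ?(ltW c0) // (bigD1 i) //= lerDl sumr_ge0.
set s := (2 / c) * \sum_i r i in h7 *.
have h8 : `|Z i j| ^+ 2 <= s by rewrite real_normK ?num_real //; lra.
by have := normr_ge0 (Z i j); nra.
Qed.

Lemma compact_consistent_set (Phi11 : 'M[R]_n) (Phi12 : 'M[R]_(n, T))
    (Phi22 : 'M[R]_T) B x u :
  negdef Phi22 -> row_free (data_Xminus T x) ->
  compact (consistent_set (block_mx Phi11 Phi12 Phi12^T Phi22) B x u).
Proof.
move=> Pneg Xfree; set Phi := block_mx _ _ _ _.
have [b bZ] := qmi_bounded Phi11 Phi12 Pneg.
pose X := data_Xminus T x; pose XU := data_XU T B x u.
pose c := \sum_i \sum_j \sum_k (`|XU i k| + `|b|) * `|pinvmx X k j|.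
have S0 i j : 0 <= \sum_k (`|XU i k| + `|b|) * `|pinvmx X k j|.
  by rewrite sumr_ge0 // => k _; rewrite mulr_ge0 // addr_ge0.
apply: (@compact_mx _ _ _ _ c) => [|A SA i j].
  have -> : consistent_set Phi B x u =
      (fun A => (col_mx 1%:M (XU - A *m X)^T)^T *m Phi *m
        col_mx 1%:M (XU - A *m X)^T) @^-1` [set M | possemidef M].
    by apply/seteqP; split => A /consistent_setE.
  apply: preimage_closed; last exact: closed_possemidef.
  move=> A _.
  have cc : (fun A => col_mx 1%:M (XU - A *m X)^T) @ nbhs A -->
      col_mx 1%:M (XU - A *m X)^T.
    apply: cvg_mx => i j; rewrite mxE; under eq_fun do rewrite mxE.
    case: splitP => k _; first exact: cvg_cst.
    apply: (@cvg_entry _ _ (nbhs A)); apply: cvg_trmx; apply: cvgB; first exact: cvg_cst.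
    by apply: cvg_mulmx; [exact: cvg_id|exact: cvg_cst].
  apply: (@cvg_mulmx _ _ (nbhs A)); last exact: cc.
  by apply: cvg_mulmx; [apply: cvg_trmx; exact: cc|exact: cvg_cst].
have AE : A = (XU - (XU - A *m X)) *m pinvmx X.
  by rewrite opprB addrC subrK -mulmxA mulmxVp // mulmx1.
have Zb := bZ _ (proj1 (consistent_setE _ _ _ _ _) SA).
apply: (le_trans (y := \sum_k (`|XU i k| + `|b|) * `|pinvmx X k j|)).
  rewrite {1}AE mxE; apply: le_trans (ler_norm_sum _ _ _) _; apply: ler_sum => k _.
  rewrite normrM ler_wpM2r // mxE; apply: le_trans (ler_normD _ _) _.
  rewrite lerD // [X in `|X|]mxE normrN; apply: le_trans (Zb i k) (ler_norm _).
rewrite /c (bigD1 i) //= (bigD1 j) //= -addrA lerDl addr_ge0 // sumr_ge0 // => k _.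
by rewrite sumr_ge0.
Qed.

End ConsistentSet.

(** * The optimal quantization density *)

Section ClosedLoopNorm.
Variable R : realType.
Local Notation cabs := (@ComplexField.Normc.normc R).
Local Open Scope ereal_scope.

Lemma hinf_norm_ge0 n (A : 'M[R]_n) B K : 0 <= hinf_norm A B K.
Proof.
rewrite /hinf_norm; case: asboolP => _ //.
apply: (le_trans (y := (cabs (transfer A B K 1))%:E)).
  by rewrite lee_fin cabs_ge0.
apply: ereal_sup_ubound; exists 1%R => //; apply/cabs1; exact: normr1.
Qed.

Lemma hinf_norm_le n (A : 'M[R]_n) B K (g : R) : schur (A + B *m K) ->
  (forall z, cabs z = 1%R -> (cabs (transfer A B K z) <= g)%R) ->
  hinf_norm A B K <= g%:E.
Proof.
move=> sA gA; rewrite /hinf_norm; case: asboolP => // _.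
by apply/ereal_supP => _ [z z1 <-]; rewrite lee_fin gA.
Qed.

Lemma hinf_norm_lt n (A : 'M[R]_n) B K (g : R) : hinf_norm A B K < g%:E ->
  schur (A + B *m K) /\
  forall z, cabs z = 1%R -> (cabs (transfer A B K z) < g)%R.
Proof.
rewrite /hinf_norm; case: asboolP => // sA hlt; split => // z z1.
rewrite -lte_fin; apply: le_lt_trans hlt.
by apply: ereal_sup_ubound; exists z.
Qed.

Lemma minmax_value_ge0 n (S : set 'M[R]_n) B : S !=set0 -> 0 <= minmax_value S B.
Proof.
move=> [A SA]; apply/ereal_infP => _ [K _ <-].
apply: le_trans (hinf_norm_ge0 A B K) _.
by apply: ereal_sup_ubound; exists A.
Qed.

End ClosedLoopNorm.

Unset Implicit Arguments.

Theorem theorem4 (R : realType) (n T : nat)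
  (As : 'M[R]_n) (B : 'cV[R]_n)
  (x : nat -> 'cV[R]_n) (u : nat -> R) (w : nat -> 'cV[R]_n)
  (Phi11 : 'M[R]_n) (Phi12 : 'M[R]_(n, T)) (Phi22 : 'M[R]_T)
  (u0 delta : R) :
  let Phi := block_mx Phi11 Phi12 Phi12^T Phi22 in
  let Sigma := consistent_set Phi B x u in
  let gamma := minmax_value Sigma B in
  stabilizable As B ->
  (forall k, (k < T)%N -> x k.+1 = As *m x k + u k *: B + w k) ->
  Phi11^T = Phi11 ->
  negdef Phi22 ->
  qmi Phi (data_W T w) ->
  0 < u0 ->
  gamma \is a fin_num ->
  0 < delta < 1 ->
  (exists K : 'rV[R]_n, forall A : 'M[R]_n, Sigma A ->
     quantized_stabilizes ((1 - delta) / (1 + delta)) u0 B K A)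
  <-> (delta%:E < gamma^-1)%E.
Proof.
move=> Phi Sigma gamma _ dyn _ Pneg qW u0p gfin d01.
have /andP[d0 d1] := d01.
have SAs : Sigma As by exact: true_system_consistent dyn qW.
have gamma_ge0 : (0 <= gamma)%E by apply: minmax_value_ge0; exists As.
have gammaE : gamma = (fine gamma)%:E by rewrite fineK.
have fg0 : 0 <= fine gamma by rewrite fine_ge0.
(* For gamma = 0 both sides hold, the inverse being +oo. *)
have ltE : (delta%:E < gamma^-1)%E = (gamma < (delta^-1)%:E)%E.
  rewrite gammaE inver lte_fin; case: eqVneq => [->|g0].
    by rewrite ltry invr_gt0 d0.
  have gp : 0 < fine gamma by rewrite lt_neqAle eq_sym g0.
  by rewrite lte_fin -[in LHS](invrK delta) ltf_pV2 ?posrE ?invr_gt0.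
rewrite ltE; split => [[K stab]|].
  pose bounded_gain (d : R) (A : 'M[R]_n) := schur (A + B *m K) /\
    forall z, ComplexField.Normc.normc z = 1 ->
      d * ComplexField.Normc.normc (transfer A B K z) < 1.
  have near_gain A : Sigma A -> \forall A' \near A & d \near delta, bounded_gain d A'.
    by move=> SA; apply: (gain_lt_near u0p d01); exact: stab.
  have sch A : Sigma A -> schur (A + B *m K).
    move=> /near_gain[[U V] /= [UA Vd] UV].
    by have [] := UV (A, delta) (conj (nbhs_singleton UA) (nbhs_singleton Vd)).
  have cS : compact Sigma.
    apply: compact_consistent_set => //; exact: row_free_data SAs sch.
  (* Compactness turns the local bounds into one for a common d > delta. *)
  have /compact_near_coveringP/(_ R (nbhs delta) bounded_gain _ near_gain) := cS.
  move=> /nbhs_ballP[e /= e0 he].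
  pose d := delta + e / 2.
  have dS A : Sigma A -> bounded_gain d A.
    apply: (he d); rewrite /ball /= /d opprD addrA subrr sub0r normrN.
    by rewrite gtr0_norm; lra.
  have dp : 0 < d by rewrite /d; lra.
  apply: (@le_lt_trans _ _ (d^-1)%:E); last first.
    by rewrite lte_fin ltf_pV2 ?posrE // /d; lra.
  apply: ge_ereal_inf; exists (ereal_sup [set hinf_norm A B K | A in Sigma]).
    by exists K.
  apply/ereal_supP => _ [A SA <-]; have [sA gA] := dS A SA.
  apply: hinf_norm_le => // z z1; rewrite -[_^-1]mulr1 ler_pdivlMl //.
  exact/ltW/gA.
move=> /ereal_inf_lt[_ [K _ <-] supK]; exists K => A SA.
have hA : (hinf_norm A B K < (delta^-1)%:E)%E.
  by apply: le_lt_trans supK; apply: ereal_sup_ubound; exists A.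
have [sA gA] := hinf_norm_lt hA.
apply: quantized_stabilizes_of_gain => // z /gA.
by rewrite -[delta^-1]mulr1 ltr_pdivlMl.
Qed.
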